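(* Consider Model $M_{[0,1]}$ with the notation of the context. For every fixed $t\in\mathbb{R}$ and each fixed integer $j\ge 0$, $$\lim_{n\to\infty}\mathbb{P}\!\left(\frac{s_{(n-j)}(n)-(n-1)\mu}{\sqrt{n-1}\,\sigma}\le x_n(t)\right)=\exp(-e^{-t})\sum_{k=0}^{j}\frac{e^{-tk}}{k!}.$$ Moreover, the convergence holds at a rate of order $(\log\log n)^2/\log n$; that is, for fixed $t$ and $j$, the absolute difference between the probability on the left and the limit on the right is $O\bigl((\log\log n)^2/\log n\bigr)$ as $n\to\infty$.
   Context: Model $M_{[0,1]}$ (round-robin tournament of $n$ equally strong players). Let $D\subset[0,1]$ be a countable set (finite or countably infinite) with $|D|>1$. For $i\ne j$, $X_{ij}$ is a $D$-valued random variable (the reward of player $i$ against player $j$) with $X_{ij}+X_{ji}=1$; in particular $a\in D$ implies $1-a\in D$. The $\binom n2$ random vectors $\{(X_{ij},X_{ji}):1\le i<j\le n\}$ are independent. All $X_{ij}$ ($i\neq j$) have the same distribution, not depending on $n$, which charges every point of $D$ and is symmetric about $1/2$: $0<\mathbb P(X_{ij}=a)=\mathbb P(X_{ji}=a)=\mathbb P(X_{ij}=1-a)$ for all $a\in D$. Put $\mu=\mathbb E(X_{ij})$ and $\sigma=\sqrt{\mathrm{Var}(X_{ij})}$. The score of player $i$ is $s_i(n)=\sum_{j\ne i,\,1\le j\le n}X_{ij}$, and $s_{(1)}(n)\le s_{(2)}(n)\le\cdots\le s_{(n)}(n)$ are the order statistics of $s_1(n),\dots,s_n(n)$. For $t\in\mathbb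 R$ put $$x_n(t)=(2\log n)^{1/2}+\frac{t-\frac{\log\log n+\log(4\pi)}{2}}{(2\log n)^{1/2}},$$ where $\log$ is the natural logarithm. *)

(* Defs.v *)
From HB Require Import structures.
From mathcomp Require Export all_boot all_order all_algebra.
From mathcomp Require Export finmap.
From mathcomp Require Export all_classical all_reals all_analysis.
Export numFieldNormedType.Exports.

Set Implicit Arguments.
Unset Strict Implicit.
Unset Printing Implicit Defensive.

Import Order.TTheory GRing.Theory Num.Theory.

Local Open Scope classical_set_scope.
Local Open Scope ring_scope.

Definition mutually_independent (R : realType) (d d' : measure_display)
    (T : measurableType d) (E : measurableType d') (P : probability T R)
    (I : choiceType) (A : set I) (Y : I -> T -> E) : Prop :=
  forall (J : {fset I}) (B : I -> set E),
    [set` J] `<=` A ->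
    (forall i, i \in J -> measurable (B i)) ->
    P (\bigcap_(i in [set` J]) (Y i @^-1` B i)) =
    (\prod_(i <- J) P (Y i @^-1` B i))%E.

Record reward_law (R : realType) (D : set R) (nu : probability R R) : Prop :=
  RewardLaw {
    reward_countable : countable D ;
    reward_unit : D `<=` `[0, 1] ;
    reward_card_gt1 : exists a b, [/\ D a, D b & a <> b] ;
    reward_pos : forall a, D a -> (0 < nu [set a])%E ;
    reward_sym : forall a, D a -> nu [set a] = nu [set 1 - a]
  }.

(* The diagonal entries [X i i] carry no meaning and are left unconstrained.
   The law is compared with [nu] on measurable sets only, since a measure is
   a total function of arbitrary sets. *)
Record tournament (R : realType) (D : set R) (nu : probability R R) (n : nat)
    (d : measure_display) (T : measurableType d) (P : probability T R)
    (X : 'I_n -> 'I_n -> {RV P >-> R}) : Prop := Tournament {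
  tournament_valued : forall i j, i != j -> forall w, D (X i j w) ;
  tournament_compl : forall i j, i != j -> forall w, X i j w + X j i w = 1 ;
  tournament_indep :
    mutually_independent P [set p : 'I_n * 'I_n | (p.1 < p.2)%N]
      (fun p w => (X p.1 p.2 w, X p.2 p.1 w) : (R * R)%type) ;
  tournament_law : forall i j, i != j ->
    forall B, measurable B -> distribution P (X i j) B = nu B
}.

Definition score (R : realType) (n : nat) (T : Type)
    (X : 'I_n -> 'I_n -> T -> R) (w : T) (i : 'I_n) : R :=
  \sum_(j < n | j != i) X i j w.

(* [k] counts from 1, as in s_(1) <= ... <= s_(n); the value for [k] outside
   1..n is irrelevant. *)
Definition order_stat (R : realType) (n : nat) (s : 'I_n -> R) (k : nat) : R :=
  nth 0 (sort <=%R [seq s i | i <- enum 'I_n]) k.-1.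

Definition gumbel_scale (R : realType) (t : R) (n : nat) : R :=
  let r := Num.sqrt (2 * ln n%:R) in
  r + (t - (ln (ln n%:R) + ln (4 * pi)) / 2) / r.

Definition order_stat_cdf (R : realType) (n : nat) (d : measure_display)
    (T : measurableType d) (P : probability T R)
    (X : 'I_n -> 'I_n -> {RV P >-> R}) (mu sigma : R) (k : nat) (x : R) : R :=
  fine (P [set w |
    (order_stat (score (fun i j => X i j : T -> R) w) k - n.-1%:R * mu)
      / (Num.sqrt n.-1%:R * sigma) <= x]).

(* Main.v *)
(* The number W of players whose score exceeds the threshold is approximately
   Poisson with parameter exp(-t), and s_(n-j) is below the threshold iff W <= j.

   Poisson approximation (Stein-Chen): let g solve the Stein equation of the
   event {W <= j}, let p_i be the probability that player i exceeds the
   threshold and V_i the number of other players that would do so even after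
   losing to i.  V_i is independent of the games of i, and W - V_i is controlled
   by the indicator of i and by the players whose remaining games bring them
   within distance 1 of the threshold.  The error is thus a sum of terms p_i^2
   and p_i times the expected number of such players, which is small as soon as
   the tail P(s_i - (n-1) mu > z + c) = (exp(-t) + O(rate)) / n is known
   uniformly in |c| <= 1, also after removing one game.

   Tail estimate: the indicator of the half-line is sandwiched between normal
   distribution functions of small variance, and the games are exchanged one by
   one for Gaussian increments by letting the heat flow run (Lindeberg).  Each
   third order remainder at y is at most a constant times
   exp(theta y + 3/4 theta^2 tau), whose mean is bounded through the moment
   generating function of the remaining games; the best theta makes the total
   error n times smaller than the rate.  Mills' ratio then evaluates the normal
   tail at the level x_n(t). *)

From mathcomp Require Import ring lra.
From mathcomp Require Import measurable_realfun.
Require Import Defs.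

Set Implicit Arguments.
Unset Strict Implicit.
Unset Printing Implicit Defensive.

Import Order.TTheory GRing.Theory Num.Theory.

Local Open Scope classical_set_scope.
Local Open Scope ring_scope.

(** The tail to be estimated has size 1/n, far below the n^(-1/2) accuracy of a Berry-Esseen bound,
    so the normal approximation has to be controlled relative to the tail itself. This is why each
    replacement error carries an exponential factor in theta instead of a uniform bound. One
    constant c = 3/4 is used for the Gaussian derivatives and for the moment generating function, so
    that their exponents add up. It must exceed 1/2 to absorb polynomial factors and higher order
    terms. At the best theta, n times the total error is n^(1/2 - 1/(2c)) up to powers of log n,
    which requires c < 1; here this is n^(-1/6). Write L = ln n. The half-line is widened by 2
    sqrt(L) standard deviations of the smoothing kernel: the normal mass beyond is at most n^(-2),
    and the kernel is so narrow that moving the threshold costs O(1/L). The rate itself appears only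
    in Mills' ratio at w = r + b/r, where r = sqrt(2L) and b is about -(ln L)/2: in w^2/2 = L + b +
    b^2/(4L) the last term has order (ln L)^2/L. *)

Lemma is_derive_continuous (R : realType) (f : R -> R) (x df : R) :
  is_derive x 1 f df -> {for x, continuous f}.
Proof. by move=> h; apply/differentiable_continuous/derivable1_diffP; case: h. Qed.

(** Writing the segment from 0 to [h] as [u * h] with u in [0, 1] covers both signs of [h] at once;
    the mean value theorem is applied to u |-> f (u h). *)
Lemma mvt_bound (R : realType) (f df : R -> R) (h K : R) :
  (forall u : R, 0 <= u <= 1 -> is_derive (u * h) 1 f (df (u * h))) ->
  (forall u : R, 0 <= u <= 1 -> `|df (u * h)| <= K) ->
  `|f h - f 0| <= K * `|h|.
Proof.
move=> fdf bdf; pose g (u : R) := f (u * h).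
have gdg (u : R) : 0 <= u <= 1 -> is_derive u 1 g (df (u * h) * h).
  move=> u01; have := fdf _ u01 => fu.
  have hu : is_derive u 1 (fun u => u * h) h.
    by apply: is_derive_eq; rewrite scaler0 add0r /GRing.scale /= mulr1.
  exact: (@is_derive1_comp _ f (fun u => u * h)).
have [||c c01] := @MVT R g (fun u => df (u * h) * h) 0 1 ltr01.
- by move=> u; rewrite in_itv /= => /andP[u0 u1]; apply: gdg; rewrite !ltW.
- apply: continuous_in_subspaceT => u; rewrite inE /= in_itv /= => u01.
  exact: (is_derive_continuous (gdg _ u01)).
rewrite /g mul1r mul0r subr0 mulr1 => ->; rewrite normrM ler_wpM2r //.
by apply: bdf; move: c01; rewrite in_itv /= => /andP[c0 c1]; rewrite !ltW.
Qed.

(** The first order bound is applied to [f] minus its tangent, whose derivative is bounded by the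
    same lemma on the segment from 0 to u h. Iterating this way loses the factorial of the Taylor
    remainder, which is harmless. *)
Lemma taylor2_bound (R : realType) (f f1 f2 : R -> R) (h K : R) :
  (forall u : R, 0 <= u <= 1 -> is_derive (u * h) 1 f (f1 (u * h))) ->
  (forall u : R, 0 <= u <= 1 -> is_derive (u * h) 1 f1 (f2 (u * h))) ->
  (forall u : R, 0 <= u <= 1 -> `|f2 (u * h)| <= K) ->
  `|f h - f 0 - f1 0 * h| <= K * `|h| ^+ 2.
Proof.
move=> d1 d2 bf.
have K0 : 0 <= K by apply: le_trans (bf 0 _); rewrite // lexx ler01.
pose g x := f x - f1 0 * x.
have dg (u : R) : 0 <= u <= 1 -> is_derive (u * h) 1 g (f1 (u * h) - f1 0).
  move=> u01; have ? := d1 _ u01.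
  by rewrite /g; apply: is_derive_eq; rewrite /GRing.scale /= mulr1.
have := @mvt_bound _ g (fun x => f1 x - f1 0) h (K * `|h|) dg.
rewrite /g mulr0 subr0 addrAC expr2 mulrA; apply => u u01.
have -> : u * h = 1 * (u * h) by rewrite mul1r.
have /andP[u0 u1] := u01.
apply: (@le_trans _ _ (K * `|u * h|)); last first.
  by rewrite ler_wpM2l// normrM ger0_norm// ler_piMl.
rewrite mul1r; apply: (@mvt_bound _ f1 f2) => v /andP[v0 v1]; rewrite mulrA.
  by apply: d2; rewrite mulr_ge0//= mulr_ile1.
by apply: bf; rewrite mulr_ge0//= mulr_ile1.
Qed.

Lemma taylor3_bound (R : realType) (f f1 f2 f3 : R -> R) (h K : R) :
  (forall u : R, 0 <= u <= 1 -> is_derive (u * h) 1 f (f1 (u * h))) ->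
  (forall u : R, 0 <= u <= 1 -> is_derive (u * h) 1 f1 (f2 (u * h))) ->
  (forall u : R, 0 <= u <= 1 -> is_derive (u * h) 1 f2 (f3 (u * h))) ->
  (forall u : R, 0 <= u <= 1 -> `|f3 (u * h)| <= K) ->
  `|f h - f 0 - f1 0 * h - f2 0 / 2 * h ^+ 2| <= K * `|h| ^+ 3.
Proof.
move=> d1 d2 d3 bf.
have K0 : 0 <= K by apply: le_trans (bf 0 _); rewrite // lexx ler01.
pose g x := f x - f1 0 * x - f2 0 / 2 * x ^+ 2.
have dg (u : R) : 0 <= u <= 1 -> is_derive (u * h) 1 g (f1 (u * h) - f1 0 - f2 0 * (u * h)).
  move=> u01; have ? := d1 _ u01.
  by rewrite /g; apply: is_derive_eq; rewrite /GRing.scale /=; field.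
have := @mvt_bound _ g (fun x => f1 x - f1 0 - f2 0 * x) h (K * `|h| ^+ 2) dg.
have -> : g h - g 0 = f h - f 0 - f1 0 * h - f2 0 / 2 * h ^+ 2 by rewrite /g; ring.
have -> : K * `|h| ^+ 2 * `|h| = K * `|h| ^+ 3 by ring.
apply => u u01; have /andP[u0 u1] := u01.
apply: (@le_trans _ _ (K * `|u * h| ^+ 2)); last first.
  rewrite ler_wpM2l// normrM ger0_norm// ler_sqr ?nnegrE ?mulr_ge0//.
  by rewrite ler_piMl.
apply: (@taylor2_bound _ f1 f2 f3) => v /andP[v0 v1]; rewrite mulrA.
- by apply: d2; rewrite mulr_ge0//= mulr_ile1.
- by apply: d3; rewrite mulr_ge0//= mulr_ile1.
by apply: bf; rewrite mulr_ge0//= mulr_ile1.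
Qed.

(** * The standard normal distribution *)

Section normal_cdf.
Context {R : realType}.
Implicit Types v x y : R.

Definition gauss_density v : R := normal_pdf 0 1 v.

Definition normal_cdf v : R := fine (normal_prob 0 1 `]-oo, v]).

Lemma gauss_densityE v :
  gauss_density v = expR (- (v ^+ 2 / 2)) / Num.sqrt (2 * pi).
Proof.
rewrite /gauss_density normal_pdfE ?oner_neq0// /normal_peak /normal_fun.
by rewrite subr0 expr1n mul1r mulrC mulNr -[pi *+ 2]mulr_natl.
Qed.

Lemma sqrt_2pi_ge1 : 1 <= Num.sqrt (2 * pi) :> R.
Proof.
rewrite -[1 in leLHS]sqrtr1 ler_sqrt; last by rewrite mulr_ge0// pi_ge0.
by have := @pi_ge2 R; lra.
Qed.

Lemma gauss_density_le v : gauss_density v <= expR (- (v ^+ 2 / 2)).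
Proof.
rewrite gauss_densityE ler_pdivrMr ?(lt_le_trans ltr01 sqrt_2pi_ge1)//.
by rewrite ler_peMr ?expR_ge0 ?sqrt_2pi_ge1.
Qed.

Lemma gauss_density_ge0 v : 0 <= gauss_density v.
Proof. exact: normal_pdf_ge0. Qed.

Lemma gauss_densityN v : gauss_density (- v) = gauss_density v.
Proof. by rewrite !gauss_densityE sqrrN. Qed.

Global Instance is_derive_gauss_density v :
  is_derive v 1 gauss_density (- v * gauss_density v).
Proof.
have -> : gauss_density = fun v => expR (- (v ^+ 2 / 2)) / Num.sqrt (2 * pi).
  by apply/funext => u; rewrite gauss_densityE.
apply: is_derive_eq.
rewrite !scaler0 /GRing.scale /=; field.
by rewrite gt_eqF// (lt_le_trans ltr01 sqrt_2pi_ge1).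
Qed.

Global Instance is_derive_normal_cdf v :
  is_derive v 1 normal_cdf (gauss_density v).
Proof.
have [] := @continuous_FTC1 R gauss_density -oo%O v (v + 1).
- by rewrite ltrDl.
- apply: (@integrableS _ _ _ _ setT) => //.
  exact: integrable_normal_pdf.
- exact: ltNyr.
- by apply: continuous_normal_pdf; rewrite oner_neq0.
move=> dF F'.
have dF2 : derivable normal_cdf v 1 := dF.
have F2 : (normal_cdf^`()%classic) v = gauss_density v := F'.
split; first exact: dF2.
by rewrite -derive1E F2.
Qed.

Lemma normal_cdf_ge0 v : 0 <= normal_cdf v.
Proof. by rewrite fine_ge0. Qed.

Lemma normal_cdf_le1 v : normal_cdf v <= 1.
Proof.
rewrite -lee_fin fineK ?fin_num_measure// probability_le1//.
Qed.

Lemma normal_cdf_nondecreasing : {homo normal_cdf : x y / x <= y}.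
Proof.
move=> x y xy; rewrite fine_le ?fin_num_measure// le_measure ?inE//.
by move=> z /=; rewrite !in_itv /= => /le_trans; apply.
Qed.

Lemma normal_cdf_cvgNy : normal_cdf x @[x --> -oo] --> (0 : R).
Proof.
have m : measurable_fun setT (idfun : measurableTypeR R -> R).
  by move=> _ B mB; rewrite setTI.
pose X := @mfun_Sub _ _ (measurableTypeR R) R idfun (mem_set m).
by apply: (fine_cvg (@cvg_cdfNy0 _ _ R (normal_prob 0 1 : probability (measurableTypeR R) R) X)).
Qed.

Lemma normal_cdf_cvgy : normal_cdf x @[x --> +oo] --> (1 : R).
Proof.
have m : measurable_fun setT (idfun : measurableTypeR R -> R).
  by move=> _ B mB; rewrite setTI.
pose X := @mfun_Sub _ _ (measurableTypeR R) R idfun (mem_set m).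
by apply: (fine_cvg (@cvg_cdfy1 _ _ R (normal_prob 0 1 : probability (measurableTypeR R) R) X)).
Qed.

Lemma normal_cdfN_cvgy : normal_cdf (- x) @[x --> +oo] --> (0 : R).
Proof. by have := normal_cdf_cvgNy; rewrite cvgNy_compNP. Qed.

(** The sum of the distribution function and its reflection has zero derivative, and its limit at
    +oo is 1. *)
Lemma normal_cdfN v : normal_cdf (- v) = 1 - normal_cdf v.
Proof.
pose h (x : R) := normal_cdf x + normal_cdf (- x).
have dh x : is_derive x 1 h 0.
  have dN : is_derive x 1 (fun x : R => - x) (- 1) by apply: is_derive_eq.
  have dc := @is_derive1_comp _ normal_cdf (fun x : R => - x) x _ _ _ dN.
  have {}dc := dc _ (is_derive_normal_cdf (- x)).
  have -> : h = normal_cdf + (normal_cdf \o (fun x : R => - x)) by [].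
  apply: is_derive_eq; rewrite gauss_densityN; ring.
have hv : h = cst (h v) by apply/funext => x; exact: is_derive_0_is_cst.
have h1 : h x @[x --> +oo] --> (1 + 0 : R).
  by apply: cvgD; [exact: normal_cdf_cvgy|exact: normal_cdfN_cvgy].
have : h v = 1 + 0.
  apply: (@cvg_unique _ (@Rhausdorff R) (h x @[x --> +oo])) => //.
  by rewrite hv; exact: cvg_cst.
by rewrite /h addr0 => <-; ring.
Qed.

(** If F v were negative, F would stay below F v from there on, against the lower bound [- e], which
    tends to 0. Both halves of Mills' ratio thereby reduce to the sign of a derivative. *)
Lemma nonincreasing_vanishing_ge0 (F dF e : R -> R) :
  (forall x, 0 < x -> is_derive x 1 F (dF x)) ->
  (forall x, 0 < x -> dF x <= 0) ->
  (forall x, 1 <= x -> - e x <= F x) ->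
  e x @[x --> +oo] --> (0 : R) ->
  forall v, 0 < v -> 0 <= F v.
Proof.
move=> FdF dF0 eF e0 v v0; rewrite leNgt; apply/negP => Fv0.
have [w [vw w1 ew]] : exists w, [/\ v < w, 1 <= w & e w < - F v].
  near (+oo : set_system R) => w; exists w; split; near: w.
  - by apply: nbhs_pinfty_gt; rewrite num_real.
  - by apply: nbhs_pinfty_ge; rewrite num_real.
  - by apply: (cvgr_lt _ e0); rewrite oppr_gt0.
have [||c /[!in_itv]/= /andP[vc _] Fc] := @MVT R F dF v w vw.
- by move=> x /[!in_itv]/= /andP[vx _]; apply: FdF; exact: lt_trans vx.
- apply: continuous_in_subspaceT => x; rewrite inE /= in_itv /= => /andP[vx _].
  exact: (is_derive_continuous (FdF _ (lt_le_trans v0 vx))).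
have := eF _ w1; rewrite leNgt => /negP; apply.
rewrite -(subrK (F v) (F w)) Fc.
apply: (@le_lt_trans _ _ (F v)); last by rewrite ltrNr.
rewrite gerDr mulr_le0_ge0// ?dF0 ?(lt_trans v0)//.
by rewrite subr_ge0 ltW.
Unshelve. all: by end_near. Qed.

Let is_derive_normal_cdfN x :
  is_derive x 1 (fun x : R => normal_cdf (- x)) (- gauss_density x).
Proof.
have dN : is_derive x 1 (fun x : R => - x) (- 1) by apply: is_derive_eq.
have dc := @is_derive1_comp _ normal_cdf (fun x : R => - x) x _ _ _ dN.
have {}dc := dc _ (is_derive_normal_cdf (- x)).
by apply: is_derive_eq; rewrite gauss_densityN; ring.
Qed.

Lemma gauss_density_le1 v : gauss_density v <= 1.
Proof.
apply: le_trans (gauss_density_le v) _.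
by rewrite expR_le1 oppr_le0 divr_ge0 ?sqr_ge0.
Qed.

Lemma normal_tail_le v : 0 < v -> normal_cdf (- v) <= gauss_density v / v.
Proof.
move=> v0; rewrite -subr_ge0; move: v v0.
apply: (@nonincreasing_vanishing_ge0
  (fun x : R => gauss_density x / x - normal_cdf (- x))
  (fun x => - gauss_density x / x ^+ 2) (fun x => normal_cdf (- x))).
- move=> x x0; have x0' : x != 0 by rewrite gt_eqF.
  have dV := @is_deriveV _ id x _ 1 x0' (is_derive_id _ _).
  have dM := is_deriveM (is_derive_gauss_density x) dV.
  apply: (is_derive_eq (is_deriveB dM (is_derive_normal_cdfN x))).
  by rewrite /GRing.scale /=; field.
- by move=> x x0; rewrite mulNr oppr_le0 divr_ge0 ?gauss_density_ge0 ?sqr_ge0.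
- move=> x x1; rewrite lerBrDr addrC subrr divr_ge0 ?gauss_density_ge0//.
  exact: le_trans x1.
- exact: normal_cdfN_cvgy.
Qed.

(** The factor 1 - v^-2 is the second term of the asymptotic expansion of the tail; with it the
    derivative of the difference collapses to -3 phi/v^4, which has a sign. *)
Lemma normal_tail_ge v : 0 < v ->
  gauss_density v / v * (1 - v ^- 2) <= normal_cdf (- v).
Proof.
move=> v0; rewrite -subr_ge0; move: v v0.
apply: (@nonincreasing_vanishing_ge0
  (fun x : R => normal_cdf (- x) - gauss_density x / x * (1 - x ^- 2))
  (fun x => - (3 * gauss_density x / x ^+ 4)) (fun x => x^-1)).
- move=> x x0; have x0' : x != 0 by rewrite gt_eqF.
  have x20 : x ^+ 2 != 0 by rewrite expf_neq0.
  have dV := @is_deriveV _ id x _ 1 x0' (is_derive_id _ _).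
  have dX : is_derive x 1 (fun y : R => y ^+ 2) (2 * x).
    by apply: is_derive_eq; rewrite /GRing.scale /=; ring.
  have dV2 := @is_deriveV _ (fun y : R => y ^+ 2) x _ 1 x20 dX.
  have dM := is_deriveM (is_derive_gauss_density x) dV.
  have dM2 := is_deriveM dM (is_deriveB (is_derive_cst (1 : R) x 1) dV2).
  apply: (is_derive_eq (is_deriveB (is_derive_normal_cdfN x) dM2)).
  rewrite /GRing.scale /= !fctE /=.
  by field.
- move=> x x0; rewrite oppr_le0; apply: divr_ge0; last by rewrite exprn_ge0// ltW.
  by rewrite mulr_ge0 ?gauss_density_ge0.
- move=> x x1; have x0 : 0 < x by exact: lt_le_trans x1.
  have : gauss_density x / x * (1 - x ^- 2) <= x^-1.
    rewrite -[leRHS]mulr1 -[leRHS]mul1r mulrA ler_pM//.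
    + by rewrite divr_ge0 ?gauss_density_ge0// ltW.
    + by rewrite subr_ge0 invf_le1 ?exprn_gt0// exprn_ege1.
    + by rewrite ler_pM2r ?invr_gt0// gauss_density_le1.
    + by rewrite gerBl invr_ge0 exprn_ge0// ltW.
  have := normal_cdf_ge0 (- x); lra.
- apply/gtr0_cvgV0; last exact: cvg_id.
  by apply: nbhs_pinfty_gt; rewrite num_real.
Qed.

End normal_cdf.

(** * One step of the replacement argument *)

Section heat_kernel.
Context {R : realType}.
Implicit Types v y s h a tau theta : R.

Lemma expR_le_quad v : `|v| <= 8^-1 -> expR v <= 1 + v + 3 / 4 * v ^+ 2.
Proof.
(* 8/7 bounds e^(1/8), as e^(-1/8) >= 7/8. The cubic remainder is then at most v^2/7, and 1/2 + 1/7
   < 3/4. *)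
move=> v8; have := @taylor3_bound R expR expR expR expR v (8 / 7).
have b u : 0 <= u <= 1 -> `|expR (u * v)| <= 8 / 7.
  move=> /andP[u0 u1]; rewrite ger0_norm ?expR_ge0//.
  have uv : u * v <= 8^-1.
    apply: le_trans v8; apply: le_trans (ler_norm _) _.
    by rewrite normrM ger0_norm// ler_piMl.
  apply: (@le_trans _ _ (expR 8^-1)); first by rewrite ler_expR.
  have e0 : 0 < expR (8^-1 : R) by exact: expR_gt0.
  have := expR_ge1Dx (- 8^-1 : R); rewrite expRN => e1.
  have : expR (8^-1 : R) * (7 / 8) <= expR 8^-1 / expR 8^-1.
    by rewrite ler_wpM2l ?(ltW e0)//; lra.
  by rewrite divff ?gt_eqF//; lra.
move=> /(_ (fun _ _ => is_derive_expR _) (fun _ _ => is_derive_expR _) (fun _ _ => is_derive_expR _) b).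
rewrite expR0 => /ler_normlW.
have : `|v| ^+ 3 <= 8^-1 * v ^+ 2.
  by rewrite -[v ^+ 2]real_normK ?num_real// exprS ler_wpM2r// sqr_ge0.
have := sqr_ge0 v; lra.
Qed.

(** Of the exponent v^2/2 a part q = v^2/6 is spent on the polynomial, leaving v^2/3. For the cubic,
    48 = 36 + 12 works because 36 (1 + q^2/2) + 12 (1 + q) dominates 18 q^2 + 12 q + 3/2. *)
Lemma poly_gauss_le v :
  (v ^+ 2 + 1) * gauss_density v <= 48 * expR (- (v ^+ 2 / 3)) /\
  `|v ^+ 3 - 3 * v| * gauss_density v <= 48 * expR (- (v ^+ 2 / 3)).
Proof.
pose q := v ^+ 2 / 6.
have q0 : 0 <= q by rewrite divr_ge0 ?sqr_ge0.
have e1 : 1 + q <= expR q := expR_ge1Dx q.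
have e2 : 1 + q ^+ 2 / 2 <= expR q by have := @expR_ge1Dxn R q 1 q0.
have -> : expR (- (v ^+ 2 / 3)) = expR q * expR (- (v ^+ 2 / 2)).
  by rewrite -expRD; congr expR; rewrite /q; field.
have vq : v ^+ 2 = 6 * q by rewrite /q; field.
split; rewrite mulrA; apply: ler_pM; rewrite ?gauss_density_ge0 ?gauss_density_le//.
- by rewrite addr_ge0 ?sqr_ge0.
- by rewrite vq; lra.
have -> : v ^+ 3 - 3 * v = v * (v ^+ 2 - 3) by ring.
rewrite normrM.
have v1 : `|v| <= (1 + v ^+ 2) / 2.
  have := sqr_ge0 (`|v| - 1); rewrite sqrrB real_normK ?num_real//.
  by rewrite expr1n mulr1 -mulr_natl; lra.
have v2 : `|v ^+ 2 - 3| <= v ^+ 2 + 3.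
  by rewrite ler_norml; have := sqr_ge0 v; lra.
apply: (@le_trans _ _ ((1 + v ^+ 2) / 2 * (v ^+ 2 + 3))).
  by rewrite ler_pM.
rewrite vq; apply: (@le_trans _ _ (18 * q ^+ 2 + 12 * q + 3 / 2)); first by lra.
by lra.
Qed.

(** Completing the square: v^2/3 and 3/4 theta^2 are convex conjugates. A Gaussian in y becomes an
    exponential in y, whose mean factors over independent games. *)
Lemma gauss_exp_le theta y s : 0 < s ->
  expR (- ((y / s) ^+ 2 / 3)) <= expR (theta * y + 3 / 4 * theta ^+ 2 * s ^+ 2).
Proof.
move=> s0; rewrite ler_expR -subr_ge0.
set v := y / s; have -> : y = v * s by rewrite /v divfK// gt_eqF.
have -> : theta * (v * s) + 3 / 4 * theta ^+ 2 * s ^+ 2 - - (v ^+ 2 / 3) =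
  (2 * v + 3 * (theta * s)) ^+ 2 / 12 by field.
by rewrite divr_ge0 ?sqr_ge0.
Qed.

(** The plus sign of the quadratic term comes from the second derivative -v phi(v). The remainder
    lives at an intermediate point y + u h, and the isolated [theta] in the exponent pays for |u h|
    <= 1. *)
Lemma heat_space s y h theta : 0 < s -> `|h| <= 1 -> 0 <= theta ->
  `|normal_cdf ((y + h) / s) - normal_cdf (y / s)
    - gauss_density (y / s) / s * h
    + y / s * gauss_density (y / s) / s ^+ 2 / 2 * h ^+ 2|
  <= 48 / s ^+ 3 * expR (theta + theta * y + 3 / 4 * theta ^+ 2 * s ^+ 2) *
     `|h| ^+ 3.
Proof.
move=> s0 h1 t0; have s0' : s != 0 by rewrite gt_eqF.
pose v (x : R) := (y + x) / s.
pose f (x : R) := normal_cdf (v x).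
pose f1 (x : R) := gauss_density (v x) / s.
pose f2 (x : R) := - (v x * gauss_density (v x)) / s ^+ 2.
pose f3 (x : R) := (v x ^+ 2 - 1) * gauss_density (v x) / s ^+ 3.
have dv (x : R) : is_derive x 1 v s^-1.
  by rewrite /v; apply: is_derive_eq; rewrite /GRing.scale /=; ring.
have d1 (x : R) : is_derive x 1 f (f1 x).
  exact: (@is_derive1_comp _ normal_cdf v x _ _ _ (dv x)).
have dg (x : R) : is_derive x 1 (fun x : R => gauss_density (v x)) (- v x * gauss_density (v x) / s).
  exact: (@is_derive1_comp _ gauss_density v x _ _ _ (dv x)).
have d2 (x : R) : is_derive x 1 f1 (f2 x).
  rewrite /f1; apply: is_derive_eq; rewrite /GRing.scale /= /f2; field.
  by [].
have d3 (x : R) : is_derive x 1 f2 (f3 x).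
  rewrite /f2; apply: is_derive_eq; rewrite /GRing.scale /= /f3; field.
  by [].
have := @taylor3_bound _ f f1 f2 f3 h
  (48 / s ^+ 3 * expR (theta + theta * y + 3 / 4 * theta ^+ 2 * s ^+ 2))
  (fun _ _ => d1 _) (fun _ _ => d2 _) (fun _ _ => d3 _).
rewrite /f /f1 /f2 /f3 /v addr0 => H.
have -> : normal_cdf ((y + h) / s) - normal_cdf (y / s) -
   gauss_density (y / s) / s * h +
   y / s * gauss_density (y / s) / s ^+ 2 / 2 * h ^+ 2 =
  normal_cdf ((y + h) / s) - normal_cdf (y / s) -
   gauss_density (y / s) / s * h -
   - (y / s * gauss_density (y / s)) / s ^+ 2 / 2 * h ^+ 2 by field.
apply: H => u /andP[u0 u1].
have s3 : 0 <= s ^- 3 by rewrite invr_ge0 exprn_ge0 ?(ltW s0).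
rewrite normrM (ger0_norm s3).
rewrite mulrAC ler_wpM2r//.
rewrite normrM [X in _ * X]ger0_norm ?gauss_density_ge0//.
set w := (y + u * h) / s.
apply: (@le_trans _ _ ((w ^+ 2 + 1) * gauss_density w)).
  rewrite ler_wpM2r ?gauss_density_ge0// ler_norml.
  by have := sqr_ge0 w; lra.
apply: le_trans (poly_gauss_le w).1 _; rewrite ler_wpM2l//.
apply: le_trans (@gauss_exp_le theta (y + u * h) s s0) _.
rewrite ler_expR lerD2r mulrDr addrC lerD2r -[leRHS]mulr1 ler_wpM2l//.
apply: le_trans (ler_norm _) _; rewrite normrM ger0_norm//.
by rewrite mulr_ile1.
Qed.

(** By the heat equation the time derivative is half the second space derivative, so the first order
    coefficient here is exactly the quadratic coefficient of [heat_space]. The second time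
    derivative produces v^3 - 3 v with a factor 1/4, whence 12 = 48/4. *)
Lemma heat_time tau y a theta : 0 < tau -> 0 <= a -> 0 <= theta ->
  `|normal_cdf (y / Num.sqrt (tau + a)) - normal_cdf (y / Num.sqrt tau)
    + y / Num.sqrt tau * gauss_density (y / Num.sqrt tau) / tau / 2 * a|
  <= 12 / tau ^+ 2 * expR (theta * y + 3 / 4 * theta ^+ 2 * (tau + a)) *
     a ^+ 2.
Proof.
move=> tau0 a0 t0.
pose q (x : R) := (Num.sqrt (tau + x))^-1.
pose f (x : R) := normal_cdf (y * q x).
pose f1 (x : R) := gauss_density (y * q x) * y * (- 2^-1 * q x ^+ 3).
pose f2 (x : R) := (3 * (y * q x) - (y * q x) ^+ 3) * gauss_density (y * q x) * q x ^+ 4 / 4.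
have q0 (x : R) : 0 <= x -> 0 < q x.
  by move=> x0; rewrite invr_gt0 sqrtr_gt0 ltr_wpDr.
have dq (x : R) : 0 <= x -> is_derive x 1 q (- 2^-1 * q x ^+ 3).
  move=> x0; have tx0 : 0 < tau + x by rewrite ltr_wpDr.
  have dt : is_derive x 1 (fun x : R => tau + x) 1 
    by apply: (is_derive_eq (is_deriveD (is_derive_cst tau x 1) (is_derive_id x 1))); rewrite add0r.
  have ds := @is_derive1_comp _ Num.sqrt (fun x : R => tau + x) x _ _ (is_derive1_sqrt tx0) dt.
  have s0 : Num.sqrt (tau + x) != 0 by rewrite gt_eqF// sqrtr_gt0.
  have dV := @is_deriveV _ (fun x : R => Num.sqrt (tau + x)) x _ 1 s0 ds.
  by apply: (is_derive_eq dV); rewrite /GRing.scale /= /q; field.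
have dv (x : R) : 0 <= x -> is_derive x 1 (fun x : R => y * q x) (y * (- 2^-1 * q x ^+ 3)).
  move=> x0; have := dq x x0 => ?.
  by apply: is_derive_eq; rewrite /GRing.scale /=; ring.
have d1 (x : R) : 0 <= x -> is_derive x 1 f (f1 x).
  move=> x0; rewrite /f1 -mulrA.
  exact: (@is_derive1_comp _ normal_cdf (fun x : R => y * q x) x _ _ _ (dv x x0)).
have d2 (x : R) : 0 <= x -> is_derive x 1 f1 (f2 x).
  move=> x0; have := dq x x0 => ?.
  have dg := @is_derive1_comp _ gauss_density (fun x : R => y * q x) x _ _ (is_derive_gauss_density _) (dv x x0).
  have {}dg : is_derive x 1 (fun x : R => gauss_density (y * q x)) _ := dg.
  by rewrite /f1; apply: is_derive_eq; rewrite /GRing.scale /= /f2; field.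
have E : y * q 0 = y / Num.sqrt tau by rewrite /q addr0.
have q2 (x : R) : 0 <= x -> q x ^+ 2 = (tau + x)^-1.
  by move=> x0; rewrite /q exprVn sqr_sqrtr// addr_ge0// ltW.
have := @taylor2_bound _ f f1 f2 a
  (12 / tau ^+ 2 * expR (theta * y + 3 / 4 * theta ^+ 2 * (tau + a))).
rewrite (ger0_norm a0) => H.
have -> : normal_cdf (y / Num.sqrt (tau + a)) - normal_cdf (y / Num.sqrt tau) +
   y / Num.sqrt tau * gauss_density (y / Num.sqrt tau) / tau / 2 * a =
  f a - f 0 - f1 0 * a.
  rewrite /f /f1 E /q; congr (_ + _); rewrite addr0 exprS -/(q 0).
  have -> : (Num.sqrt tau)^-1 ^+ 2 = tau^-1 by rewrite exprVn sqr_sqrtr// ltW.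
  ring.
apply: H => u /andP[u0 u1]; have ua : 0 <= u * a by rewrite mulr_ge0.
- exact: d1.
- exact: d2.
set w := y * q (u * a).
have q4 : q (u * a) ^+ 4 = (tau + u * a) ^- 2.
  by rewrite -[4%N]/(2 * 2)%N exprM q2// exprVn.
have tu : 0 < tau + u * a by rewrite ltr_wpDr.
have -> : `|f2 (u * a)| = `|w ^+ 3 - 3 * w| * gauss_density w * ((tau + u * a) ^- 2 / 4).
  have c0 : 0 <= gauss_density w * ((tau + u * a) ^- 2 / 4).
    by rewrite mulr_ge0 ?gauss_density_ge0// divr_ge0// invr_ge0 exprn_ge0// ltW.
  by rewrite /f2 -/w q4 -!mulrA normrM distrC (ger0_norm c0).
apply: (@le_trans _ _ (48 * expR (- (w ^+ 2 / 3)) * ((tau + u * a) ^- 2 / 4))).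
  apply: ler_wpM2r; last exact: (poly_gauss_le w).2.
  by rewrite divr_ge0// invr_ge0 exprn_ge0// ltW.
have -> : 48 * expR (- (w ^+ 2 / 3)) * ((tau + u * a) ^- 2 / 4) =
  12 / (tau + u * a) ^+ 2 * expR (- (w ^+ 2 / 3)).
  by field; rewrite gt_eqF.
rewrite ler_pM ?expR_ge0// ?divr_ge0 ?exprn_ge0 ?(ltW tu)//.
  rewrite ler_wpM2l// lef_pV2 ?posrE ?exprn_gt0// ler_sqr ?nnegrE ?(ltW tu) ?(ltW tau0)//.
  by rewrite lerDl.
have s0 : 0 < Num.sqrt (tau + u * a) by rewrite sqrtr_gt0.
apply: le_trans (@gauss_exp_le theta y _ s0) _.
rewrite sqr_sqrtr ?(ltW tu)// ler_expR lerD2l ler_wpM2l ?mulr_ge0 ?sqr_ge0//.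
by rewrite lerD2l ler_piMl.
Qed.

(** The terms kept on the left, in [h] and in [h ^+ 2 - a], are those that average to 0 when [h] is
    centered with variance [a] and independent of [y]. The constant is 48 + 12, and 1 <= tau lets
    the time error tau^-2 be absorbed into tau^(-3/2). *)
Lemma heat_step tau y h a theta :
  1 <= tau -> `|h| <= 1 -> 0 <= a -> a <= 1 -> 0 <= theta ->
  `|normal_cdf ((y + h) / Num.sqrt tau) - normal_cdf (y / Num.sqrt (tau + a))
    - gauss_density (y / Num.sqrt tau) / Num.sqrt tau * h
    + y / Num.sqrt tau * gauss_density (y / Num.sqrt tau) / tau / 2
      * (h ^+ 2 - a)|
  <= 60 / Num.sqrt tau ^+ 3 *
     expR (theta + theta * y + 3 / 4 * theta ^+ 2 * (tau + a)).
Proof.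
move=> tau1 h1 a0 a1 t0; have tau0 : 0 < tau by exact: lt_le_trans tau1.
have s1 : 1 <= Num.sqrt tau by rewrite -[leLHS]sqrtr1 ler_wsqrtr.
have s0 : 0 < Num.sqrt tau by exact: lt_le_trans s1.
have A := @heat_space (Num.sqrt tau) y h theta s0 h1 t0.
have B := @heat_time tau y a theta tau0 a0 t0.
have ss : Num.sqrt tau ^+ 2 = tau by rewrite sqr_sqrtr// ltW.
rewrite ss in A.
set c := y / Num.sqrt tau * gauss_density (y / Num.sqrt tau) / tau / 2 in A B *.
set u1 := normal_cdf ((y + h) / _) in A B *.
set u2 := normal_cdf (y / Num.sqrt tau) in A B *.
set u3 := normal_cdf (y / Num.sqrt (_ + _)) in A B *.
set l := gauss_density _ / _ * h in A *.
have -> : u1 - u3 - l + c * (h ^+ 2 - a) =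
  (u1 - u2 - l + c * h ^+ 2) - (u3 - u2 + c * a) by ring.
apply: le_trans (ler_normB _ _) _.
set E := expR _.
have -> : 60 / Num.sqrt tau ^+ 3 * E =
  48 / Num.sqrt tau ^+ 3 * E + 12 / Num.sqrt tau ^+ 3 * E by rewrite -mulrDl -mulrDl; congr (_ / _ * _); lra.
apply: lerD.
  apply: le_trans A _; rewrite -[leRHS]mulr1 ler_pM//.
  - rewrite ler_wpM2l ?divr_ge0 ?exprn_ge0 ?(ltW s0)// ler_expR lerD2l.
    by rewrite ler_wpM2l ?mulr_ge0 ?sqr_ge0// lerDl.
  - by rewrite exprn_ile1.
apply: le_trans B _; rewrite -[leRHS]mulr1 ler_pM//.
- by rewrite mulr_ge0 ?expR_ge0// divr_ge0// exprn_ge0// ltW.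
- by rewrite sqr_ge0.
- rewrite ler_pM ?expR_ge0 ?divr_ge0 ?exprn_ge0 ?(ltW tau0)//.
    rewrite ler_wpM2l// lef_pV2 ?posrE ?exprn_gt0// -[X in _ <= X ^+ 2]ss -exprM.
    by rewrite ler_weXn2l.
  by rewrite ler_expR -addrA lerDr.
- by rewrite exprn_ile1.
Qed.

End heat_kernel.

(** * Means of bounded random variables *)

Section mean.
Context d (T : measurableType d) (R : realType) (P : probability T R).
Implicit Types f g : T -> R.

Definition mean f : R := \int[P]_w f w.

Definition bdd f := exists M, forall w, `|f w| <= M.

Definition bdd_mfun f := measurable_fun setT f /\ bdd f.

Lemma bdd_cst r : bdd (fun _ => r).
Proof. by exists `|r|. Qed.

Lemma bddD f g : bdd f -> bdd g -> bdd (fun w => f w + g w).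
Proof.
move=> [M fM] [N gN]; exists (M + N) => w.
by rewrite (le_trans (ler_normD _ _))// lerD.
Qed.

Lemma bddN f : bdd f -> bdd (fun w => - f w).
Proof. by move=> [M fM]; exists M => w; rewrite normrN. Qed.

Lemma bddB f g : bdd f -> bdd g -> bdd (fun w => f w - g w).
Proof. by move=> bf bg; apply: bddD => //; exact: bddN. Qed.

Lemma bddM f g : bdd f -> bdd g -> bdd (fun w => f w * g w).
Proof. by move=> [M fM] [N gN]; exists (M * N) => w; rewrite normrM ler_pM. Qed.

Lemma bdd_natr (b : T -> bool) : bdd (fun w => (b w)%:R).
Proof. by exists 1 => w; case: (b w); rewrite /= ?normr1 ?normr0. Qed.

Lemma bdd_mfunD f g : bdd_mfun f -> bdd_mfun g -> bdd_mfun (fun w => f w + g w).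
Proof.
by move=> [mf bf] [mg bg]; split; [exact: measurable_funD|exact: bddD].
Qed.

Lemma bdd_mfun_integrable f : bdd_mfun f -> P.-integrable setT (EFin \o f).
Proof.
move=> [mf [M fM]]; apply: measurable_bounded_integrable => //.
  by rewrite (le_lt_trans (probability_le1 _ _))// ltry.
exists M; split; first by rewrite num_real.
by move=> x Mx w _ /=; apply: le_trans (fM w) _; exact: ltW.
Qed.

Lemma meanD f g : bdd_mfun f -> bdd_mfun g ->
  mean (fun w => f w + g w) = mean f + mean g.
Proof. by move=> /bdd_mfun_integrable fi /bdd_mfun_integrable gi; exact: RintegralD. Qed.

Lemma meanB f g : bdd_mfun f -> bdd_mfun g ->
  mean (fun w => f w - g w) = mean f - mean g.
Proof. by move=> /bdd_mfun_integrable fi /bdd_mfun_integrable gi; exact: RintegralB. Qed.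

Lemma meanZ (r : R) f : bdd_mfun f -> mean (fun w => r * f w) = r * mean f.
Proof. by move=> /bdd_mfun_integrable fi; exact: RintegralZl. Qed.

Lemma mean_cst (r : R) : mean (fun _ => r) = r.
Proof. by rewrite /mean Rintegral_cst//= probability_setT mulr1. Qed.

Lemma mean_le f g : bdd_mfun f -> bdd_mfun g -> (forall w, f w <= g w) ->
  mean f <= mean g.
Proof.
move=> /bdd_mfun_integrable fi /bdd_mfun_integrable gi fg.
by apply: le_Rintegral => // w _; exact: fg.
Qed.

Lemma mean_ge0 f : (forall w, 0 <= f w) -> 0 <= mean f.
Proof. by move=> f0; exact: Rintegral_ge0. Qed.

Lemma mean_norm_le f g : bdd_mfun f -> bdd_mfun g ->
  (forall w, `|f w| <= g w) -> `|mean f| <= mean g.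
Proof.
move=> bf bg fg; rewrite ler_norml; apply/andP; split.
  rewrite -mulN1r -meanZ//; apply: mean_le => //.
    case: bg => mg bg; split; first exact: measurable_funM.
    by apply: bddM => //; exact: bdd_cst.
  by move=> w; have := fg w; rewrite ler_norml mulN1r => /andP[].
by apply: mean_le => // w; exact: le_trans (ler_norm _) (fg w).
Qed.

Lemma mean_sum (I : Type) (s : seq I) (F : I -> T -> R) :
  (forall i, bdd_mfun (F i)) ->
  mean (fun w => \sum_(i <- s) F i w) = \sum_(i <- s) mean (F i) /\
  bdd_mfun (fun w => \sum_(i <- s) F i w).
Proof.
move=> bF; elim: s => [|i s [IH bs]].
  split; first by under [mean _]eq_Rintegral do rewrite big_nil;
    rewrite big_nil; exact: mean_cst.
  under eq_fun do rewrite big_nil.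
  by split; [exact: measurable_cst|exact: bdd_cst].
split; last by under eq_fun do rewrite big_cons; exact: bdd_mfunD.
by under [mean _]eq_Rintegral do rewrite big_cons; rewrite big_cons -IH; exact: meanD.
Qed.

Lemma mean_natr (b : T -> bool) : measurable [set w | b w] ->
  mean (fun w => (b w)%:R) = fine (P [set w | b w]).
Proof.
move=> mb; rewrite /mean /Rintegral.
under eq_integral => w _.
  have -> : (b w)%:R = \1_[set w | b w] w :> R.
    by rewrite indicE; congr (_%:R); rewrite mem_setE.
  over.
by rewrite integral_indic// setIT.
Qed.

Definition indep2 f g := forall A B : set R, measurable A -> measurable B ->
  P (f @^-1` A `&` g @^-1` B) = (P (f @^-1` A) * P (g @^-1` B))%E.

(** The joint law and the product of the marginals agree on rectangles, hence coincide; Tonelli's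
    theorem then separates the integral. *)
Let mean_mul_indep_ge0 f g : bdd_mfun f -> bdd_mfun g ->
  (forall w, 0 <= f w) -> (forall w, 0 <= g w) -> indep2 f g ->
  mean (fun w => f w * g w) = mean f * mean g.
Proof.
move=> bf bg f0 g0 fg; have [mf _] := bf; have [mg _] := bg.
pose F : {mfun T >-> R} := mfun_Sub (mem_set mf).
pose G : {mfun T >-> R} := mfun_Sub (mem_set mg).
pose m1 : probability R R := distribution P F.
pose m2 : probability R R := distribution P G.
pose FG w : R * R := (f w, g w).
have mFG : measurable_fun setT FG by exact: measurable_fun_pair.
(* The absolute values make the integrand nonnegative on the whole plane, as Tonelli requires; they
   disappear on the range of the nonnegative [f] and [g]. *)
pose h (z : R * R) : \bar R := (`|z.1| * `|z.2|)%:E.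
have mh : measurable_fun setT h.
  apply/measurable_EFinP; apply: measurable_funM.
    by apply: measurableT_comp => //; exact: measurable_fst.
  by apply: measurableT_comp => //; exact: measurable_snd.
have h0 z : (0 <= h z)%E by rewrite lee_fin mulr_ge0.
have mnorm : measurable_fun setT (fun x : R => `|x|%:E) by apply/measurable_EFinP.
have E1 : (\int[pushforward P FG]_z h z = \int[P]_w (f w * g w)%:E)%E.
  rewrite ge0_integral_pushforward// preimage_setT; apply: eq_integral => w _ /=.
  by rewrite /h /= !ger0_norm.
have E2 : (\int[pushforward P FG]_z h z = \int[m1 \x m2]_z h z)%E.
  apply: eq_measure_integral => A mA _.
  rewrite [RHS](@product_measure_unique _ _ _ _ _ m1 m2 (pushforward P FG))//.
have E3 : (\int[m1 \x m2]_z h z = \int[m1]_x \int[m2]_y h (x, y))%E.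
  by rewrite -fubini_tonelli1.
have fm : (\int[m1]_x `|x|%:E = \int[P]_w (f w)%:E)%E.
  rewrite ge0_integral_pushforward// preimage_setT; apply: eq_integral => w _ /=.
  by rewrite ger0_norm.
have gm : (\int[m2]_x `|x|%:E = \int[P]_w (g w)%:E)%E.
  rewrite ge0_integral_pushforward// preimage_setT; apply: eq_integral => w _ /=.
  by rewrite ger0_norm.
have gfin : (\int[P]_w (g w)%:E)%E \is a fin_num.
  by apply: integrable_fin_num => //; exact: bdd_mfun_integrable.
have ffin : (\int[P]_w (f w)%:E)%E \is a fin_num.
  by apply: integrable_fin_num => //; exact: bdd_mfun_integrable.
have E4 : (\int[m1]_x \int[m2]_y h (x, y) =
    \int[m1]_x (`|x|%:E * \int[P]_w (g w)%:E))%E.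
  by apply: eq_integral => x _; rewrite -gm -ge0_integralZl_EFin.
rewrite /mean /Rintegral -E1 E2 E3 E4.
rewrite ge0_integralZr//; last by apply: integral_ge0 => w _; rewrite lee_fin.
by rewrite fm fineM.
Qed.

(** Adding the bounds [M] and [N] makes both factors nonnegative; expanding the product and using
    linearity removes them again. *)
Lemma mean_mul_indep f g : bdd_mfun f -> bdd_mfun g -> indep2 f g ->
  mean (fun w => f w * g w) = mean f * mean g.
Proof.
move=> bf bg fg; have [mf [M fM]] := bf; have [mg [N gN]] := bg.
have bM : bdd_mfun (fun _ => M) by split; [exact: measurable_cst|exact: bdd_cst].
have bN : bdd_mfun (fun _ => N) by split; [exact: measurable_cst|exact: bdd_cst].
have bfg : bdd_mfun (fun w => f w * g w).
  by split; [exact: measurable_funM|apply: bddM; [case: bf|case: bg]].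
have bNf : bdd_mfun (fun w => N * f w).
  by split; [exact: measurable_funM|apply: bddM; [exact: bdd_cst|case: bf]].
have bMg : bdd_mfun (fun w => M * g w).
  by split; [exact: measurable_funM|apply: bddM; [exact: bdd_cst|case: bg]].
have H : mean (fun w => (f w + M) * (g w + N)) =
    mean (fun w => f w + M) * mean (fun w => g w + N).
  apply: mean_mul_indep_ge0.
  - exact: bdd_mfunD.
  - exact: bdd_mfunD.
  - by move=> w; have := fM w; rewrite ler_norml => /andP[]; lra.
  - by move=> w; have := gN w; rewrite ler_norml => /andP[]; lra.
  move=> A B mA mB; have := fg ((fun x => x + M) @^-1` A) ((fun x => x + N) @^-1` B).
  apply.
    by rewrite -[X in measurable X]setTI; exact: measurable_funD.
  by rewrite -[X in measurable X]setTI; exact: measurable_funD.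
have : mean (fun w => f w * g w + (N * f w + (M * g w + M * N))) =
    (mean f + M) * (mean g + N).
  rewrite -[X in (_ + X) * _]mean_cst -[X in _ * (_ + X)]mean_cst -!meanD//.
  by rewrite -H; congr mean; apply/funext => w; ring.
rewrite !meanD//; last 3 first.
- by split; [exact: measurable_cst|exact: bdd_cst].
- by apply: bdd_mfunD => //; split; [exact: measurable_cst|exact: bdd_cst].
- by apply: bdd_mfunD => //; apply: bdd_mfunD => //; split; [exact: measurable_cst|exact: bdd_cst].
by rewrite mean_cst !meanZ//; lra.
Qed.

(** Countable additivity over the points of [A] extends the product rule from atoms to arbitrary
    sets. [nat_indep] uses this once in each coordinate. *)
Lemma preimage_nat_indep (k : T -> nat) (A : set nat) (E : set T) (p : R) :
  (forall a, measurable (k @^-1` [set a])) -> measurable E -> 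
  (forall a, P (k @^-1` [set a] `&` E) = P (k @^-1` [set a]) * p%:E)%E ->
  (P (k @^-1` A `&` E) = P (k @^-1` A) * p%:E)%E.
Proof.
move=> mk mE kE.
have pre : k @^-1` A = \bigcup_(a in A) k @^-1` [set a].
  by rewrite -preimage_bigcup; congr (_ @^-1` _); rewrite bigcup_imset1 image_id.
rewrite pre setI_bigcupl.
rewrite measure_bigcup//=; last 2 first.
- by move=> a _; exact: measurableI.
- move=> a b _ _ [w [[/= <- _] [/= <- _]]] //.
rewrite measure_bigcup//=; last exact: trivIset_preimage1.
under eq_eseriesr do rewrite kE muleC.
by rewrite nneseriesZl// muleC.
Qed.

Lemma nat_indep (k l : T -> nat) (A B : set nat) :
  (forall a, measurable (k @^-1` [set a])) ->
  (forall a, measurable (l @^-1` [set a])) ->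
  (forall a b, P (k @^-1` [set a] `&` l @^-1` [set b]) =
    P (k @^-1` [set a]) * P (l @^-1` [set b]))%E ->
  (P (k @^-1` A `&` l @^-1` B) = P (k @^-1` A) * P (l @^-1` B))%E.
Proof.
move=> mk ml kl.
have mB : measurable (l @^-1` B).
  have -> : l @^-1` B = \bigcup_(a in B) l @^-1` [set a].
    by rewrite -preimage_bigcup; congr (_ @^-1` _); rewrite bigcup_imset1 image_id.
  exact: bigcup_measurable.
rewrite -[P (l @^-1` B)]fineK ?fin_num_measure//.
apply: preimage_nat_indep => // a; rewrite fineK ?fin_num_measure//.
rewrite setIC muleC -[P (k @^-1` _)]fineK ?fin_num_measure//.
apply: preimage_nat_indep => // b; rewrite fineK ?fin_num_measure//.
by rewrite setIC muleC.
Qed.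

End mean.

(** * Events determined by a set of games *)

Section games.
Context (R : realType) (D : set R) (nu : probability R R).
Hypothesis hnu : reward_law D nu.
Context (n : nat) d (T : measurableType d) (P : probability T R).
Context (X : 'I_n -> 'I_n -> {RV P >-> R}).
Hypothesis hX : tournament D nu X.
Implicit Types (J : {set 'I_n * 'I_n}) (p : 'I_n * 'I_n).

(** A pointwise substitute for measurability with respect to the games in [J]. Only pairs in
    increasing order are read, since the other orientation is given by the complement to 1. *)
Definition determined_by J (C : Type) (f : T -> C) := forall w w',
  (forall p, p \in J -> (p.1 < p.2)%N -> X p.1 p.2 w = X p.1 p.2 w') ->
  f w = f w'.

(* [D] being countable, the results of the games in [J] can be encoded by one
   natural number, so that independence has to be checked on atoms only. *)
Let e : R -> nat := sval (cid (elimT (countable_injP D) (reward_countable hnu))).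

Let e_inj : {in D &, injective e}.
Proof. exact: (svalP (cid (elimT (countable_injP D) (reward_countable hnu)))). Qed.

Let code J w : nat := choice.pickle
  [ffun p : 'I_n * 'I_n =>
    if (p \in J) && (p.1 < p.2)%N then e (X p.1 p.2 w) else 0%N].

Let code_inj J w w' : code J w = code J w' ->
  forall p, p \in J -> (p.1 < p.2)%N -> X p.1 p.2 w = X p.1 p.2 w'.
Proof.
move=> /(pcan_inj choice.pickleK)/ffunP ww' p pJ p12; have := ww' p.
have p12' : p.1 != p.2 by apply: contraTneq p12 => ->; rewrite ltnn.
rewrite !ffunE pJ p12 /=; apply: e_inj; rewrite inE; exact: tournament_valued hX _ _ _ _.
Qed.

Let code_ext J w w' :
  (forall p, p \in J -> (p.1 < p.2)%N -> X p.1 p.2 w = X p.1 p.2 w') ->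
  code J w = code J w'.
Proof.
move=> ww'; congr choice.pickle; apply/ffunP => p; rewrite !ffunE.
by case: ifP => // /andP[pJ p12]; rewrite ww'.
Qed.

Let games_in J : {fset 'I_n * 'I_n} :=
  [fset p in enum [set p in J | (p.1 < p.2)%N]%SET]%fset.

Let in_games_in J p : (p \in games_in J) = (p \in J) && (p.1 < p.2)%N.
Proof. by rewrite /games_in inE /= mem_enum inE. Qed.

(** Independence is assumed for the pairs of results of a game, so an atom is expressed in the plane
    by constraining the first coordinate alone. *)
Let slice w p : set (R * R) := [set X p.1 p.2 w] `*` setT.

Let measurable_slice w p : measurable (slice w p).
Proof. exact: measurableX. Qed.

Let result p w : R * R := (X p.1 p.2 w, X p.2 p.1 w).

Let measurable_result p : measurable_fun setT (result p).
Proof. exact: measurable_fun_pair. Qed.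

Let code_fiber J w0 : code J @^-1` [set code J w0] =
  \bigcap_(p in [set` games_in J]) (result p @^-1` slice w0 p).
Proof.
apply/seteqP; split => w /=.
  move=> /code_inj H p /=; rewrite in_games_in => /andP[pJ p12].
  by split => //=; exact: H.
move=> H; apply: code_ext => p pJ p12.
by have /= := H p; rewrite in_games_in pJ p12 => /(_ isT)[].
Qed.

Let code_fiber_measurable J a : measurable (code J @^-1` [set a]).
Proof.
have [[w0 <-]|a0] := pselect (exists w0, code J w0 = a).
  rewrite code_fiber; apply: fin_bigcap_measurable; first exact: finite_fset.
  move=> p _; rewrite -[X in measurable X]setTI; exact: measurable_result.
rewrite (_ : _ @^-1` _ = set0) //; apply/seteqP; split => // w /= wa.
by apply: a0; exists w.
Qed.

Let prob_slices J (B : 'I_n * 'I_n -> set (R * R)) : (forall p, measurable (B p)) ->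
  P (\bigcap_(p in [set` games_in J]) (result p @^-1` B p)) =
  (\prod_(p | (p \in J) && (p.1 < p.2)%N) P (result p @^-1` B p))%E.
Proof.
move=> mB; rewrite (tournament_indep hX)//; last first.
  by move=> p /=; rewrite in_games_in => /andP[].
rewrite big_uniq ?fset_uniq//=; apply: eq_bigl => p; exact: in_games_in.
Qed.

(** With representatives [w0] and [w1] of nonempty fibers, both fibers and their intersection are
    described by one family of slices, taken from [w0] on [J] and from [w1] elsewhere. Mutual
    independence turns each into a product over games, and the product over the union splits by
    disjointness. *)
Let code_indep J J' a b : {in J, forall p, p \notin J'} ->
  P (code J @^-1` [set a] `&` code J' @^-1` [set b]) =
  (P (code J @^-1` [set a]) * P (code J' @^-1` [set b]))%E.
Proof.
move=> JJ'.
have [[w0 <-]|a0] := pselect (exists w0, code J w0 = a); last first.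
  rewrite (_ : code J @^-1` [set a] = set0); last first.
    by apply/seteqP; split => // w /= wa; apply: a0; exists w.
  by rewrite set0I measure0 mul0e.
have [[w1 <-]|b0] := pselect (exists w1, code J' w1 = b); last first.
  rewrite (_ : code J' @^-1` [set b] = set0); last first.
    by apply/seteqP; split => // w /= wa; apply: b0; exists w.
  by rewrite setI0 measure0 mule0.
pose B p := slice (if p \in J then w0 else w1) p.
have mB p : measurable (B p) by exact: measurable_slice.
have E0 : code J @^-1` [set code J w0] =
    \bigcap_(p in [set` games_in J]) (result p @^-1` B p).
  rewrite code_fiber; apply: eq_bigcapr => p /=.
  by rewrite in_games_in /B => /andP[-> _].
have E1 : code J' @^-1` [set code J' w1] =
    \bigcap_(p in [set` games_in J']) (result p @^-1` B p).
  rewrite code_fiber; apply: eq_bigcapr => p /=.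
  rewrite in_games_in /B => /andP[pJ' _].
  by case: ifP => // pJ; have := negbTE (JJ' _ pJ); rewrite pJ'.
have -> : code J @^-1` [set code J w0] `&` code J' @^-1` [set code J' w1] =
    \bigcap_(p in [set` games_in (J :|: J')]) (result p @^-1` B p).
  rewrite E0 E1; apply/seteqP; split => w /=.
    move=> [H0 H1] p /=; rewrite in_games_in finset.in_setU andb_orl => /orP[]pJ.
      by apply: H0; rewrite /= in_games_in.
    by apply: H1; rewrite /= in_games_in.
  move=> H; split => p /=; rewrite in_games_in => /andP[pJ p12]; apply: H;
    by rewrite /= in_games_in finset.in_setU pJ ?orbT.
rewrite E0 E1 !prob_slices// (bigID (mem J))/=; congr (_ * _)%E; apply: eq_bigl => p.
  by rewrite finset.in_setU; case: (p \in J); rewrite ?andbF ?andbT //= ?andbF.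
rewrite finset.in_setU; case: (boolP (p \in J)) => pJ /=.
  by rewrite andbF (negbTE (JJ' _ pJ)).
by rewrite andbT.
Qed.

Let lift_code J (C : Type) (f : T -> C) : determined_by J f -> forall B : set C,
  exists A : set nat, f @^-1` B = code J @^-1` A.
Proof.
move=> fJ B; exists (code J @` (f @^-1` B)); apply/seteqP; split => w /=.
  by move=> Bw; exists w.
move=> [w' Bw' /code_inj ww']; rewrite -(_ : f w' = f w)//; exact: fJ.
Qed.

(** Such an [f] factors through the code, so the preimage of an arbitrary set is a countable union
    of measurable fibers. *)
Lemma determined_measurable J (C : Type) (f : T -> C) (B : set C) :
  determined_by J f -> measurable (f @^-1` B).
Proof.
move=> fJ; have [A ->] := lift_code fJ B.
have -> : code J @^-1` A = \bigcup_(a in A) code J @^-1` [set a].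
  by rewrite -preimage_bigcup; congr (_ @^-1` _); rewrite bigcup_imset1 image_id.
exact: bigcup_measurable.
Qed.

Lemma determined_measurable_fun J (f : T -> R) :
  determined_by J f -> measurable_fun setT f.
Proof. by move=> fJ _ B mB; rewrite setTI; exact: determined_measurable fJ. Qed.

Lemma determined_bdd_mfun J (f : T -> R) :
  determined_by J f -> bdd f -> bdd_mfun f.
Proof. by move=> fJ bf; split => //; exact: determined_measurable_fun fJ. Qed.

Lemma determined_indep2 J J' (f g : T -> R) : {in J, forall p, p \notin J'} ->
  determined_by J f -> determined_by J' g -> indep2 P f g.
Proof.
move=> JJ' fJ gJ' A B _ _.
have [A' ->] := lift_code fJ A; have [B' ->] := lift_code gJ' B.
by apply: nat_indep => // a b; exact: code_indep.
Qed.

Lemma mean_mul_determined J J' (f g : T -> R) : {in J, forall p, p \notin J'} ->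
  determined_by J f -> determined_by J' g -> bdd f -> bdd g ->
  mean P (fun w => f w * g w) = mean P f * mean P g.
Proof.
move=> JJ' fJ gJ' bf bg; apply: mean_mul_indep.
- exact: determined_bdd_mfun fJ bf.
- exact: determined_bdd_mfun gJ' bg.
- exact: determined_indep2 JJ' fJ gJ'.
Qed.

Lemma determined_comp J (B C : Type) (h : B -> C) (f : T -> B) :
  determined_by J f -> determined_by J (fun w => h (f w)).
Proof. by move=> fJ w w' ww'; rewrite (fJ w w'). Qed.

Lemma determined_comp2 J (A B C : Type) (h : A -> B -> C) (f : T -> A) (g : T -> B) :
  determined_by J f -> determined_by J g -> determined_by J (fun w => h (f w) (g w)).
Proof. by move=> fJ gJ w w' ww'; rewrite (fJ w w')// (gJ w w'). Qed.

Lemma determinedS J J' (C : Type) (f : T -> C) : J \subset J' ->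
  determined_by J f -> determined_by J' f.
Proof. by move=> /fintype.subsetP JJ' fJ w w' ww'; apply: fJ => p pJ; apply: ww'; exact: JJ'. Qed.

Lemma determined_game J i k : i != k -> (i, k) \in J -> (k, i) \in J ->
  determined_by J (X i k).
Proof.
move=> ik ikJ kiJ w w' ww'.
have : (i < k)%N || (k < i)%N by rewrite -neq_ltn.
case/orP => [ik'|ki']; first exact: (ww' (i, k)).
have := tournament_compl hX ik w; have := tournament_compl hX ik w'.
have /= -> := ww' (k, i) kiJ ki'.
by move=> <- /(congr1 (fun x => x - X k i w')); rewrite !addrK.
Qed.

End games.

Section bounded_images.
Context d (T : measurableType d) (R : realType).
Implicit Types f : T -> R.

Lemma bdd_expR f : bdd f -> bdd (fun w => expR (f w)).
Proof.
move=> [M fM]; exists (expR M) => w; rewrite ger0_norm ?expR_ge0// ler_expR.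
exact: le_trans (ler_norm _) (fM w).
Qed.

Lemma bdd_normal_cdf f : bdd (fun w => normal_cdf (f w)).
Proof. by exists 1 => w; rewrite ger0_norm ?normal_cdf_ge0 ?normal_cdf_le1. Qed.

Lemma bdd_gauss_density f : bdd (fun w => gauss_density (f w)).
Proof. by exists 1 => w; rewrite ger0_norm ?gauss_density_ge0 ?gauss_density_le1. Qed.

Lemma bdd_sum (I : Type) (s : seq I) (Q : pred I) (F : I -> T -> R) :
  (forall i, Q i -> bdd (F i)) -> bdd (fun w => \sum_(i <- s | Q i) F i w).
Proof.
move=> bF; elim: s => [|i s [M IH]].
  by exists 0 => w; rewrite big_nil normr0.
case: (boolP (Q i)) => Qi; last by exists M => w; rewrite big_cons (negbTE Qi).
have [N HN] := bF i Qi; exists (N + M) => w; rewrite big_cons Qi.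
by rewrite (le_trans (ler_normD _ _))// lerD.
Qed.

End bounded_images.

(** * Lindeberg's method for the score of a player *)

Section score_sums.
Context (R : realType) (D : set R) (nu : probability R R).
Hypothesis hnu : reward_law D nu.
Context (n : nat) d (T : measurableType d) (P : probability T R).
Context (X : 'I_n -> 'I_n -> {RV P >-> R}).
Hypothesis hX : tournament D nu X.
Context (mu sigma : R).
Hypothesis hmu : forall i k, i != k -> ('E_P[X i k] = mu%:E)%E.
Hypothesis hsigma : forall i k, i != k -> sigma = Num.sqrt (fine ('V_P[X i k])%E).
Implicit Types (i k : 'I_n) (s : seq 'I_n) (w : T).

Lemma reward_bdd i k w : i != k -> 0 <= X i k w <= 1.
Proof.
move=> ik; have := reward_unit hnu (tournament_valued hX ik w).
by rewrite /= in_itv.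
Qed.

Lemma bdd_reward i k : i != k -> bdd (X i k).
Proof.
move=> ik; exists 1 => w; have /andP[x0 x1] := reward_bdd w ik.
by rewrite ger0_norm.
Qed.

Lemma bdd_mfun_reward i k : i != k -> bdd_mfun (X i k : T -> R).
Proof. by move=> ik; split; [|exact: bdd_reward]. Qed.

Lemma mean_reward i k : i != k -> mean P (X i k) = mu.
Proof. by move=> ik; rewrite /mean /Rintegral -expectation_def hmu. Qed.

Lemma mu_itv i k : i != k -> 0 <= mu <= 1.
Proof.
move=> ik; rewrite -(mean_reward ik); apply/andP; split.
  by apply: mean_ge0 => w; have /andP[] := reward_bdd w ik.
rewrite -[leRHS](mean_cst P); apply: mean_le; first exact: bdd_mfun_reward.
  by split; [exact: measurable_cst|exact: bdd_cst].
by move=> w; have /andP[] := reward_bdd w ik.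
Qed.

Lemma centered_reward_le1 i k w : i != k -> `|X i k w - mu| <= 1.
Proof.
move=> ik; have /andP[x0 x1] := reward_bdd w ik; have /andP[m0 m1] := mu_itv ik.
by rewrite ler_norml; lra.
Qed.

Lemma bdd_centered_reward i k : i != k -> bdd (fun w => X i k w - mu).
Proof. by move=> ik; exists 1 => w; exact: centered_reward_le1. Qed.

Lemma bdd_mfun_centered_reward i k : i != k -> bdd_mfun (fun w => X i k w - mu).
Proof.
by move=> ik; split; [exact: measurable_funB|exact: bdd_centered_reward].
Qed.

Lemma bdd_mfun_centered_reward2 i k : i != k ->
  bdd_mfun (fun w => (X i k w - mu) ^+ 2).
Proof.
move=> ik; have [m b] := bdd_mfun_centered_reward ik.
split; first exact: measurable_funX.
by under eq_fun do rewrite expr2; exact: bddM.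
Qed.

Lemma mean_centered_reward i k : i != k -> mean P (fun w => X i k w - mu) = 0.
Proof.
move=> ik; rewrite meanB ?mean_cst ?mean_reward ?subrr//; first exact: bdd_mfun_reward.
by split; [exact: measurable_cst|exact: bdd_cst].
Qed.

Lemma mean_centered_reward2 i k : i != k ->
  mean P (fun w => (X i k w - mu) ^+ 2) = sigma ^+ 2.
Proof.
move=> ik; rewrite (hsigma ik) sqr_sqrtr ?fine_ge0 ?variance_ge0//.
rewrite /mean /Rintegral /variance unlock; congr fine.
rewrite unlock; apply: eq_integral => w _ /=.
rewrite -[(\int[P]_w _)%E]expectation_def hmu//=.
Qed.

(** Since [D] has two points, one of them, c, differs from [mu], and it is charged. Then (c - mu)^2
    P(X = c) <= sigma^2 excludes sigma = 0. *)
Lemma sigma_gt0 i k : i != k -> 0 < sigma.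
Proof.
move=> ik; have s0 : 0 <= sigma by rewrite (hsigma ik) sqrtr_ge0.
rewrite lt_neqAle s0 andbT eq_sym; apply/eqP => sigma0.
have [a [b [Da Db ab]]] := reward_card_gt1 hnu.
have [c [Dc cmu]] : exists c, D c /\ c != mu.
  by have [amu|amu] := eqVneq a mu; [exists b; split=> //; apply/eqP => bmu; apply: ab; rewrite amu bmu|exists a].
have mc : measurable [set c] by exact: measurable_set1.
have mXc : measurable [set w | X i k w == c].
  rewrite (_ : [set w | X i k w == c] = X i k @^-1` [set c]).
    by rewrite -[X in measurable X]setTI; exact: measurable_funP.
  by apply/seteqP; split => w /= /eqP.
have bc : bdd_mfun (fun w => (X i k w == c)%:R : R).
  split; last exact: bdd_natr.
  have -> : (fun w => (X i k w == c)%:R) = \1_[set w | X i k w == c] :> (T -> R).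
    by apply/funext => w; rewrite indicE; congr (_%:R); rewrite mem_setE.
  exact: measurable_indic.
have : (c - mu) ^+ 2 * mean P (fun w => (X i k w == c)%:R) <= sigma ^+ 2.
  rewrite -(mean_centered_reward2 ik) -meanZ//; apply: mean_le.
  - split; first by apply: measurable_funM => //; case: bc.
    by apply: bddM; [exact: bdd_cst|case: bc].
  - exact: bdd_mfun_centered_reward2.
  - by move=> w; case: eqP => [->|_]; rewrite ?mulr1// mulr0 sqr_ge0.
rewrite mean_natr// sigma0 expr0n /= => H.
have : 0 < fine (P [set w | X i k w == c]).
  rewrite fine_gt0// (_ : [set w | X i k w == c] = X i k @^-1` [set c]); last first.
    by apply/seteqP; split => w /= /eqP.
  have := tournament_law hX ik mc; rewrite /distribution /pushforward => ->.
  rewrite (reward_pos hnu Dc)/=; have := @probability_le1 _ _ _ nu _ mc.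
  by move=> /le_lt_trans; apply; rewrite ltry.
have : 0 < (c - mu) ^+ 2 by rewrite exprn_even_gt0//= subr_eq0.
by move=> /mulr_gt0 h /h; rewrite ltNge H.
Qed.

Lemma sigma2_le1 i k : i != k -> sigma ^+ 2 <= 1.
Proof.
move=> ik; rewrite -(mean_centered_reward2 ik) -[leRHS](mean_cst P).
apply: mean_le; first exact: bdd_mfun_centered_reward2.
  by split; [exact: measurable_cst|exact: bdd_cst].
by move=> w; rewrite -real_normK ?num_real// exprn_ile1// centered_reward_le1.
Qed.

(** The opponents form a list because the replacement argument peels off its head, and because the
    full list and the list with one opponent removed both occur later. *)
Definition centered_sum i s w : R := \sum_(k <- s) (X i k w - mu).

(** Both orientations are included, so that it does not matter whether [i] or the opponent has the
    smaller index. *)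
Definition games_against i s : {set 'I_n * 'I_n} :=
  [set p : 'I_n * 'I_n | (p.1 == i) && (p.2 \in s) || (p.2 == i) && (p.1 \in s)]%SET.

Lemma determined_centered_reward i k s : i != k -> k \in s ->
  determined_by X (games_against i s) (fun w => X i k w - mu).
Proof.
move=> ik ks; apply: (determined_comp (fun x : R => x - mu)).
by apply: (determined_game hX) => //; rewrite inE /= eqxx ks ?orbT.
Qed.

Lemma determined_centered_sum i s : i \notin s ->
  determined_by X (games_against i s) (centered_sum i s).
Proof.
move=> is_ w w' ww'; rewrite /centered_sum; apply: eq_big_seq => k ks.
have ik : i != k by apply: contraNneq is_ => ->.
by have := determined_centered_reward ik ks ww'.
Qed.

Lemma games_against_disjoint i k s : i \notin k :: s -> k \notin s ->
  {in games_against i [:: k], forall p, p \notin games_against i s}.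
Proof.
move=> iks ks [a b]; rewrite !inE /= => /orP[]/andP[/eqP -> /eqP ->].
  by rewrite eqxx (negbTE ks) /=; move: iks; rewrite inE negb_or eq_sym => /andP[/negbTE -> _].
by rewrite eqxx (negbTE ks) /=; move: iks; rewrite inE negb_or eq_sym => /andP[/negbTE -> _].
Qed.

Lemma bdd_centered_sum i s : i \notin s -> bdd (centered_sum i s).
Proof.
elim: s => [|k s IH]; first by exists 0 => w; rewrite /centered_sum big_nil normr0.
rewrite inE negb_or => /andP[ik /IH bs].
have -> : centered_sum i (k :: s) = (fun w => (X i k w - mu) + centered_sum i s w).
  by apply/funext => w; rewrite /centered_sum big_cons.
by apply: bddD => //; exact: bdd_centered_reward.
Qed.

(** The condition theta <= 1/8 brings the exponent into the range of [expR_le_quad], and the linear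
    term has mean 0. The constant 3/4 agrees with [gauss_exp_le], so the two exponents merge in
    [lindeberg]. *)
Lemma mgf_centered_reward theta i k : i != k -> 0 <= theta <= 8^-1 ->
  mean P (fun w => expR (theta * (X i k w - mu))) <=
  expR (3 / 4 * theta ^+ 2 * sigma ^+ 2).
Proof.
move=> ik /andP[t0 t8].
have b1 := bdd_mfun_centered_reward ik; have b2 := bdd_mfun_centered_reward2 ik.
have bc (c : R) : bdd_mfun (fun _ : T => c) by split; [exact: measurable_cst|exact: bdd_cst].
have bZ (c : R) (f : T -> R) : bdd_mfun f -> bdd_mfun (fun w => c * f w).
  by move=> [mf bf]; split; [exact: measurable_funM|apply: bddM => //; exact: bdd_cst].
apply: (@le_trans _ _ (mean P (fun w => 1 + (theta * (X i k w - mu) +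
    3 / 4 * theta ^+ 2 * (X i k w - mu) ^+ 2)))).
  apply: mean_le.
  - have [m b] := bZ theta _ b1; split; last exact: bdd_expR.
    exact: measurableT_comp.
  - by apply: bdd_mfunD => //; apply: bdd_mfunD; exact: bZ.
  - move=> w; apply: le_trans (expR_le_quad _) _.
      rewrite normrM ger0_norm// -[leRHS]mulr1 ler_pM// centered_reward_le1//.
    by rewrite exprMn; lra.
rewrite !meanD ?mean_cst//; last 3 first.
- exact: bZ.
- exact: bZ.
- by apply: bdd_mfunD; exact: bZ.
rewrite !meanZ// mean_centered_reward// mean_centered_reward2// mulr0 add0r.
exact: expR_ge1Dx.
Qed.

Lemma mgf_centered_sum theta i s : uniq s -> i \notin s -> 0 <= theta <= 8^-1 ->
  mean P (fun w => expR (theta * centered_sum i s w)) <=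
  expR (3 / 4 * theta ^+ 2 * (sigma ^+ 2 * (size s)%:R)).
Proof.
move=> + + t8; elim: s => [_ _|k s IH /=/andP[ks us] iks].
  rewrite (_ : (fun w => _) = (fun _ => 1)) ?mean_cst.
    by rewrite -[leLHS]expR0 ler_expR !mulr0.
  by apply/funext => w; rewrite /centered_sum big_nil mulr0 expR0.
have := iks; rewrite inE negb_or => /andP[ik is_].
have -> : (fun w => expR (theta * centered_sum i (k :: s) w)) =
    (fun w => expR (theta * (X i k w - mu)) * expR (theta * centered_sum i s w)).
  by apply/funext => w; rewrite -expRD -mulrDr /centered_sum big_cons.
rewrite (mean_mul_determined hnu hX (games_against_disjoint iks ks)).
- rewrite -[(size s).+1%:R]natr1 (_ : 3 / 4 * _ * _ = 3 / 4 * theta ^+ 2 * sigma ^+ 2 +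
    3 / 4 * theta ^+ 2 * (sigma ^+ 2 * (size s)%:R)); last by ring.
  rewrite expRD ler_pM//.
  + by apply: mean_ge0 => w; exact: expR_ge0.
  + by apply: mean_ge0 => w; exact: expR_ge0.
  + exact: mgf_centered_reward.
  + exact: IH.
- apply: (determined_comp (fun x : R => expR (theta * x))).
  by apply: determined_centered_reward; rewrite ?mem_head.
- apply: (determined_comp (fun x : R => expR (theta * x))).
  exact: determined_centered_sum.
- by apply: bdd_expR; apply: bddM; [exact: bdd_cst|exact: bdd_centered_reward].
- by apply: bdd_expR; apply: bddM; [exact: bdd_cst|exact: bdd_centered_sum].
Qed.

(* Lindeberg replacement along the heat flow: one game is traded for a variance
   increment [sigma ^+ 2] of the smoothing kernel, so that [tau + sigma ^+ 2 * size s]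
   is invariant; the tilt [theta] keeps each error proportional to the tail. *)
Lemma lindeberg tau0 theta z i s tau : 1 <= tau0 -> 0 <= theta <= 8^-1 ->
  uniq s -> i \notin s -> tau0 <= tau ->
  `|mean P (fun w => normal_cdf ((centered_sum i s w - z) / Num.sqrt tau)) -
    normal_cdf (- z / Num.sqrt (tau + sigma ^+ 2 * (size s)%:R))| <=
  (size s)%:R * (60 / Num.sqrt tau0 ^+ 3 *
    expR (theta - theta * z + 3 / 4 * theta ^+ 2 * (tau + sigma ^+ 2 * (size s)%:R))).
Proof.
move=> tau01 t8; have /andP[t0 _] := t8.
elim: s tau => [|k s IH] tau.
  move=> _ _ _; rewrite mul0r (_ : (fun w => _) = (fun _ => normal_cdf (- z / Num.sqrt tau))).
    by rewrite mean_cst mulr0 addr0 subrr normr0.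
  by apply/funext => w; rewrite /centered_sum big_nil add0r.
move=> /= /andP[ks us] iks tau0tau.
have := iks; rewrite inE negb_or => /andP[ik is_].
have tau1 : 1 <= tau by exact: le_trans tau0tau.
set a := sigma ^+ 2; have a0 : 0 <= a by exact: sqr_ge0.
have a1 : a <= 1 by exact: sigma2_le1 ik.
have /IH : tau0 <= tau + a by rewrite (le_trans tau0tau)// lerDl.
move=> /(_ us is_); rewrite -/a -[(size s).+1%:R]natr1.
have -> : tau + a * ((size s)%:R + 1) = tau + a + a * (size s)%:R by ring.
set V := tau + a + a * (size s)%:R.
set err := 60 / _ * _ => H.
pose y w := centered_sum i s w - z.
pose h w := X i k w - mu.
pose A w := gauss_density (y w / Num.sqrt tau) / Num.sqrt tau.
pose B w := y w / Num.sqrt tau * gauss_density (y w / Num.sqrt tau) / tau / 2.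
pose U1 w := normal_cdf ((y w + h w) / Num.sqrt tau).
pose U2 w := normal_cdf (y w / Num.sqrt (tau + a)).
have EU1 w : normal_cdf ((centered_sum i (k :: s) w - z) / Num.sqrt tau) = U1 w.
  rewrite /U1 /y /h [centered_sum i (k :: s) w]big_cons -/(centered_sum i s w).
  by rewrite -addrA [X in X / _]addrC.
rewrite (funext EU1).
have dS := determined_centered_sum is_.
have dH := determined_centered_reward ik (mem_head k [::]).
have bS := bdd_centered_sum is_.
have disj := games_against_disjoint iks ks.
have disj' : {in games_against i s, forall p, p \notin games_against i [:: k]}.
  by move=> p ps; apply/negP => /disj; rewrite ps.
have dA : determined_by X (games_against i s) A.
  exact: (determined_comp (fun x => gauss_density ((x - z) / Num.sqrt tau) / Num.sqrt tau) dS).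
have dB : determined_by X (games_against i s) B.
  exact: (determined_comp (fun x => (x - z) / Num.sqrt tau * gauss_density ((x - z) / Num.sqrt tau) / tau / 2) dS).
have dU2 : determined_by X (games_against i s) U2.
  exact: (determined_comp (fun x => normal_cdf ((x - z) / Num.sqrt (tau + a))) dS).
have dh2 : determined_by X (games_against i [:: k]) (fun w => h w ^+ 2 - a).
  exact: (determined_comp (fun x => x ^+ 2 - a) dH).
have bh : bdd h by exact: bdd_centered_reward.
have bh2 : bdd (fun w => h w ^+ 2 - a).
  by apply: bddB; [case: (bdd_mfun_centered_reward2 ik)|exact: bdd_cst].
have bA : bdd A by apply: bddM; [exact: bdd_gauss_density|exact: bdd_cst].
have bB : bdd B.
  apply: bddM; [|exact: bdd_cst]; apply: bddM; [|exact: bdd_cst].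
  apply: bddM; [|exact: bdd_gauss_density]; apply: bddM; [|exact: bdd_cst].
  by apply: bddB => //; exact: bdd_cst.
have dU1 : determined_by X [set: _]%SET U1.
  apply: (determined_comp2 (fun x y => normal_cdf ((x - z + y) / Num.sqrt tau)) (f := centered_sum i s) (g := h)).
    by apply: (determinedS _ dS); exact: finset.subsetT.
  by apply: (determinedS _ dH); exact: finset.subsetT.
have mU1 : bdd_mfun U1 by apply: (determined_bdd_mfun hnu hX dU1); exact: bdd_normal_cdf.
have mU2 : bdd_mfun U2 by apply: (determined_bdd_mfun hnu hX dU2); exact: bdd_normal_cdf.
have mA : bdd_mfun A by exact: (determined_bdd_mfun hnu hX dA).
have mB : bdd_mfun B by exact: (determined_bdd_mfun hnu hX dB).
have mh : bdd_mfun h by exact: bdd_mfun_centered_reward.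
have mh2 : bdd_mfun (fun w => h w ^+ 2 - a) by exact: (determined_bdd_mfun hnu hX dh2).
have mM (f g : T -> R) : bdd_mfun f -> bdd_mfun g -> bdd_mfun (fun w => f w * g w).
  by move=> [mf bf] [mg bg]; split; [exact: measurable_funM|exact: bddM].
have mN (f g : T -> R) : bdd_mfun f -> bdd_mfun g -> bdd_mfun (fun w => f w - g w).
  by move=> [mf bf] [mg bg]; split; [exact: measurable_funB|exact: bddB].
have mean_h2 : mean P (fun w => h w ^+ 2 - a) = 0.
  rewrite meanB ?mean_cst ?mean_centered_reward2 ?subrr//.
    exact: bdd_mfun_centered_reward2.
  by split; [exact: measurable_cst|exact: bdd_cst].
(* [A] and [B] depend only on the games in [s], hence are independent of the game against [k]; the
   means of [h] and of [h ^+ 2 - a] vanish. *)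
have E : mean P (fun w => U1 w - U2 w - A w * h w + B w * (h w ^+ 2 - a)) =
    mean P U1 - mean P U2.
  rewrite meanD; [|by apply: (mN); [exact: mN|exact: mM]|exact: mM].
  rewrite meanB; [|exact: mN|exact: mM].
  rewrite meanB// (mean_mul_determined hnu hX disj' dA dH bA bh).
  rewrite (mean_mul_determined hnu hX disj' dB dh2 bB bh2).
  by rewrite mean_centered_reward// mean_h2 !mulr0 subr0 addr0.
pose c := 60 / Num.sqrt tau ^+ 3 * expR (theta - theta * z + 3 / 4 * theta ^+ 2 * (tau + a)).
have c0 : 0 <= c.
  by rewrite mulr_ge0 ?expR_ge0// divr_ge0// exprn_ge0// sqrtr_ge0.
have mE : bdd_mfun (fun w => expR (theta * centered_sum i s w)).
  apply: (determined_bdd_mfun hnu hX (J := games_against i s)).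
    exact: (determined_comp (fun x => expR (theta * x)) dS).
  by apply: bdd_expR; apply: bddM => //; exact: bdd_cst.
have step : `|mean P U1 - mean P U2| <= err.
  rewrite -E; apply: (@le_trans _ _ (mean P (fun w => c * expR (theta * centered_sum i s w)))).
    apply: mean_norm_le.
    - by apply: bdd_mfunD; [apply: (mN); [exact: mN|exact: mM]|exact: mM].
    - by apply: (mM) => //; split; [exact: measurable_cst|exact: bdd_cst].
    - move=> w; apply: le_trans (heat_step (y w) tau1 (centered_reward_le1 w ik) a0 a1 t0) _.
      rewrite /c -[leRHS]mulrA -expRD ler_wpM2l//.
      by rewrite le_eqVlt; apply/orP; left; apply/eqP; congr expR; rewrite /y; ring.
  rewrite meanZ// /c /err -[leLHS]mulrA.
  have tt : 0 < Num.sqrt tau0 ^+ 3 by rewrite exprn_gt0// sqrtr_gt0 (lt_le_trans ltr01).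
  apply: ler_pM.
  - by rewrite divr_ge0// exprn_ge0// sqrtr_ge0.
  - by rewrite mulr_ge0 ?expR_ge0// mean_ge0// => w; exact: expR_ge0.
  - rewrite ler_wpM2l// lef_pV2 ?posrE//.
      by rewrite lerXn2r ?nnegrE ?sqrtr_ge0// ler_wsqrtr.
    by rewrite exprn_gt0// sqrtr_gt0 (lt_le_trans ltr01).
  (* The moment generating function of the remaining games supplies the missing 3/4 theta^2 a |s|,
     which completes tau + a to the invariant [V]. Every game therefore contributes the same
     error. *)
  apply: (@le_trans _ _ (expR (theta - theta * z + 3 / 4 * theta ^+ 2 * (tau + a)) *
     expR (3 / 4 * theta ^+ 2 * (a * (size s)%:R)))).
    by rewrite ler_wpM2l ?expR_ge0// mgf_centered_sum.
  by rewrite -expRD; rewrite le_eqVlt; apply/orP; left; apply/eqP; congr expR; rewrite /V; ring.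
rewrite -(subrK (mean P U2) (mean P U1)) -addrA (le_trans (ler_normD _ _))//.
rewrite mulrDl mul1r [leRHS]addrC; apply: lerD; first exact: step.
exact: H.
Qed.

End score_sums.

(** * Asymptotics at the Gumbel level *)

Section gumbel_asymptotics.
Context {R : realType}.
Implicit Types t K L M sigma v w z V : R.

Definition rate L : R := ln L ^+ 2 / L.

(* Here and below [L] stands for [ln n], and [level t L] for [gumbel_scale t n]. *)
Definition level t L : R :=
  Num.sqrt (2 * L) + (t - (ln L + ln (4 * pi)) / 2) / Num.sqrt (2 * L).

Lemma near_ge K : \forall L \near +oo, K <= L.
Proof. by apply: nbhs_pinfty_ge; rewrite num_real. Qed.

Lemma near_ln_ge K : \forall L \near +oo, K <= ln L.
Proof.
near=> L; have L0 : 0 < L.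
  by apply: (@lt_le_trans _ _ 1) => //; near: L; exact: near_ge.
by rewrite -[K]expRK ler_ln ?posrE ?expR_gt0//; near: L; exact: near_ge.
Unshelve. all: by end_near. Qed.

(** With y = ln L the claim is K y^2 <= e^y, which follows from e^y >= y^3/3! once y >= 6 |K|. As K
    is arbitrary, this also says that the rate tends to 0. *)
Lemma near_rate_le K : \forall L \near +oo, K * rate L <= 1.
Proof.
near=> L.
have L0 : 0 < L by apply: (@lt_le_trans _ _ 1) => //; near: L; exact: near_ge.
have y1 : 1 <= ln L by near: L; exact: near_ln_ge.
have yK : 6 * `|K| <= ln L by near: L; exact: near_ln_ge.
set y := ln L in y1 yK; have Ly : L = expR y by rewrite lnK.
have y0 : 0 <= y by exact: le_trans y1.
rewrite /rate -/y mulrA ler_pdivrMr// mul1r Ly.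
have := @expR_ge1Dxn R y 2 y0; rewrite (_ : (3`!)%:R = 6) // => H.
apply: (@le_trans _ _ (y / 6 * y ^+ 2)).
  by rewrite ler_wpM2r ?sqr_ge0//; have := ler_norm K; lra.
by apply: le_trans H; rewrite exprS; lra.
Unshelve. all: by end_near. Qed.

Lemma inv_le_rate L : 1 <= L -> 1 <= ln L -> L^-1 <= rate L.
Proof.
move=> L1 lnL; rewrite /rate ler_peMl ?invr_ge0 ?(le_trans _ L1)//.
by rewrite exprn_ege1.
Qed.

(** Mills' ratio at w = r (1 + p) with w^2/2 = L + b + q leaves the factor e^(-q)/(1 + p), and its
    lower bound an additional 1 - c with c = w^-2. *)
Lemma exp_ratio_bounds (p q c : R) :
  `|p| <= 4^-1 -> `|q| <= 4^-1 -> 0 <= c <= 1 ->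
  expR (- q) / (1 + p) <= 1 + 4 * (`|p| + `|q| + c) /\
  1 - 4 * (`|p| + `|q| + c) <= expR (- q) / (1 + p) * (1 - c).
Proof.
move=> p4 q4 /andP[c0 c1].
have := ler_norm p; have := ler_norm (- p); rewrite normrN => np pp.
have := ler_norm q; have := ler_norm (- q); rewrite normrN => nq pq.
have p0 := normr_ge0 p; have q0 := normr_ge0 q.
have e1 : expR (- q) <= 1 + 2 * `|q|.
  have a0 : 0 < 1 - `|q| by lra.
  have : expR (- q) * (1 - `|q|) <= 1.
    rewrite -[leRHS](_ : expR (- q) * expR q = 1); last by rewrite -expRD addNr expR0.
    by rewrite ler_wpM2l ?expR_ge0// (le_trans _ (expR_ge1Dx q))//; lra.
  rewrite -ler_pdivlMr// => /le_trans; apply.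
  by rewrite ler_pdivrMr//; nra.
have e2 : 1 - `|q| <= expR (- q) by apply: le_trans (expR_ge1Dx _); lra.
have p1 : 0 < 1 + p by lra.
have i1 : (1 + p)^-1 <= 1 + 2 * `|p|.
  rewrite -[leLHS]mul1r ler_pdivrMr//.
  apply: (@le_trans _ _ ((1 + 2 * `|p|) * (1 - `|p|))); first by nra.
  by rewrite ler_wpM2l//; lra.
have i2 : 1 - `|p| <= (1 + p)^-1.
  rewrite -[leRHS]mul1r ler_pdivlMr//.
  apply: (@le_trans _ _ ((1 - `|p|) * (1 + `|p|))); last by nra.
  by rewrite ler_wpM2l//; lra.
split.
  apply: (@le_trans _ _ ((1 + 2 * `|q|) * (1 + 2 * `|p|))); last by nra.
  by rewrite ler_pM ?expR_ge0// invr_ge0 ltW.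
apply: (@le_trans _ _ ((1 - `|q|) * (1 - `|p|) * (1 - c))).
  have h1 : 1 - `|q| - `|p| <= (1 - `|q|) * (1 - `|p|) by nra.
  have h2 : (1 - `|q| - `|p|) * (1 - c) <= (1 - `|q|) * (1 - `|p|) * (1 - c).
    by rewrite ler_wpM2r//; lra.
  by apply: le_trans h2; nra.
rewrite ler_wpM2r//; first by lra.
by rewrite ler_pM//; lra.
Qed.

(** The distance to the level is multiplied by r = sqrt(2L) because w^2/2 then moves by O(rate)
    only. Quantifying [w] after [L] makes the bounds uniform over thresholds. The last bound serves
    the replacement error, whose exponent at the best tilt is -w^2/3. *)
Lemma gumbel_tail t K : 0 <= K -> exists C, \forall L \near +oo, forall w,
  `|w - level t L| * Num.sqrt (2 * L) <= K * rate L ->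
  [/\ 0 < w, w <= 2 * Num.sqrt (2 * L),
    `|expR L * normal_cdf (- w) - expR (- t)| <= C * rate L &
    expR (- (w ^+ 2 / 3)) <= C * L * expR (- (2 / 3 * L))].
Proof.
move=> K0; pose cb := `|t| + 1 + ln (4 * pi).
have pi4 : 1 <= 4 * pi :> R by have := @pi_ge2 R; lra.
have lpi : 0 <= ln (4 * pi : R) by exact: ln_ge0.
have cb1 : 1 <= cb by rewrite /cb; have := normr_ge0 t; lra.
(* [c1] dominates the coefficients of the rate in the bounds for |p|, |q| and w^-2, namely cb + K,
   cb^2 + 2K + K^2 and 2. *)
pose c1 := cb ^+ 2 + 3 * K + K ^+ 2 + 2.
have c10 : 0 <= c1 by rewrite /c1; have := sqr_ge0 cb; have := sqr_ge0 K; lra.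
have cbcb : cb <= cb ^+ 2 by rewrite expr2 ler_peMl// (le_trans _ cb1).
have c1p : cb + K <= c1 by rewrite /c1; have := sqr_ge0 K; lra.
have c1q : cb ^+ 2 + 2 * K + K ^+ 2 <= c1 by rewrite /c1; lra.
have c12 : 2 <= c1 by rewrite /c1; have := sqr_ge0 K; have := sqr_ge0 cb; lra.
have tcb : `|t| + 1 <= cb by rewrite /cb; lra.
have lcb : ln (4 * pi) / 2 + `|t| + 1 / 2 <= cb by rewrite /cb; lra.
clearbody c1 cb.
pose c2 := 2 * (1 + expR (- t) * (4 * pi)).
have c20 : 0 <= c2.
  rewrite /c2 mulr_ge0// addr_ge0// mulr_ge0 ?expR_ge0//; lra.
exists (12 * expR (- t) * c1 + c2); near=> L => w wK.
have L1 : 1 <= L by near: L; exact: near_ge.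
have L0 : 0 < L by exact: lt_le_trans L1.
have lnL : 1 <= ln L by near: L; exact: near_ln_ge.
have Le := inv_le_rate L1 lnL.
have c1e : 4 * c1 * rate L <= 1 by near: L; exact: near_rate_le.
have e1 : 1 * rate L <= 1 by near: L; exact: near_rate_le.
rewrite mul1r in e1; set e := rate L in Le c1e e1 wK *.
have e0 : 0 <= e by rewrite (le_trans _ Le)// invr_ge0 ltW.
set r := Num.sqrt (2 * L).
have r2 : r ^+ 2 = 2 * L by rewrite sqr_sqrtr// mulr_ge0// ltW.
have r0 : 0 < r by rewrite sqrtr_gt0 mulr_gt0.
have r1 : 1 <= r by rewrite -[leLHS]sqrtr1 ler_wsqrtr//; lra.
have r0' : r != 0 by rewrite gt_eqF.
pose b := t - (ln L + ln (4 * pi)) / 2.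
have bcb : `|b| <= cb * ln L.
  apply: (@le_trans _ _ (`|t| + (ln L + ln (4 * pi)) / 2)).
    rewrite /b (le_trans (ler_normB _ _))// lerD2l ger0_norm//; lra.
  apply: (@le_trans _ _ ((ln (4 * pi) / 2 + `|t| + 1 / 2) * ln L)).
    have h1 : `|t| <= `|t| * ln L by rewrite ler_peMr.
    have h2 : ln (4 * pi) / 2 <= ln (4 * pi) / 2 * ln L by rewrite ler_peMr// divr_ge0.
    clear -h1 h2; lra.
  by rewrite ler_wpM2r// (le_trans _ lnL).
have b2 : b ^+ 2 / L <= cb ^+ 2 * e.
  rewrite /e /rate mulrA ler_pM2r ?invr_gt0// -exprMn -[leLHS]real_normK ?num_real//.
  by apply: lerXn2r; rewrite ?nnegrE ?normr_ge0// (le_trans _ bcb).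
have bL : `|b| / L <= cb * e.
  rewrite /e /rate mulrA ler_pM2r ?invr_gt0// (le_trans bcb)//.
  by rewrite ler_wpM2l ?(le_trans ler01 cb1)// expr2 ler_peMl// (le_trans ler01 lnL).
pose D := w - level t L.
have Dr : `|D| * r <= K * e := wK.
have D0 : `|D| <= K * e by apply: le_trans Dr; rewrite ler_peMr.
have wE : w = r + b / r + D by rewrite /D /level -/r -/b; ring.
pose p := b / (2 * L) + D / r.
have wp : w = r * (1 + p).
  by rewrite wE /p -r2; field.
(* The first term, with b of size ln L, is the source of the rate (ln L)^2/L; the other two come
   from the displacement [D]. *)
pose q := b ^+ 2 / (4 * L) + (r + b / r) * D + D ^+ 2 / 2.
have L0' : L != 0 by rewrite gt_eqF.
have wq : w ^+ 2 / 2 = L + b + q.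
  have -> : w ^+ 2 / 2 = r ^+ 2 / 2 + b + b ^+ 2 / (2 * r ^+ 2) + (r + b / r) * D + D ^+ 2 / 2.
    by rewrite wE; field.
  by rewrite r2 /q; field; rewrite ?r0' ?L0'.
(* The centering of [level] is made for this identity: sqrt(4 pi L) = sqrt(2 pi) r cancels the
   normalization of the density and the main part of the denominator w, so only e^(-t) survives. *)
have eb : expR (- b) = expR (- t) * Num.sqrt (4 * pi * L).
  have pL : 0 < 4 * pi * L by rewrite mulr_gt0// (lt_le_trans ltr01 pi4).
  rewrite -[Num.sqrt _]lnK ?posrE ?sqrtr_gt0// -expRD -powR12_sqrt ?(ltW pL)// ln_powR.
  rewrite (_ : 4 * pi * L = L * (4 * pi)) ?(mulrC L)// lnM ?posrE ?(lt_le_trans ltr01 pi4)//.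
  by congr expR; rewrite /b; ring.
clearbody b D; clear wK bcb.
have n2L : `|2 * L| = 2 * L by rewrite ger0_norm// mulr_ge0// ltW.
have nr : `|r| = r by rewrite ger0_norm// ltW.
have n2 : `|2^-1| = 2^-1 :> R by rewrite ger0_norm.
have pc : `|p| <= (cb + K) * e.
  rewrite /p (le_trans (ler_normD _ _))// [leRHS]mulrDl lerD//.
    rewrite normrM normfV n2L (le_trans _ bL)//.
    by rewrite ler_wpM2l// lef_pV2 ?posrE ?mulr_gt0// ler_peMl ?(ltW L0)// ler1n.
  rewrite normrM normfV nr ler_pdivrMr// (le_trans D0)//.
  by rewrite ler_peMr// mulr_ge0.
have qc : `|q| <= (cb ^+ 2 + 2 * K + K ^+ 2) * e.
  have q1 : `|b ^+ 2 / (4 * L)| <= cb ^+ 2 * e / 4.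
    rewrite ger0_norm; last by rewrite divr_ge0 ?sqr_ge0 ?mulr_ge0 ?(ltW L0).
    by rewrite (_ : _ / _ = b ^+ 2 / L / 4); [lra|field].
  have q2 : `|(r + b / r) * D| <= K * e + cb * e * (K * e).
    rewrite mulrDl (le_trans (ler_normD _ _))// lerD//.
      by rewrite normrM mulrC nr.
    rewrite (_ : b / r * D = b / (2 * L) * (D * r)); last by rewrite -r2; field.
    rewrite normrM ler_pM//.
      rewrite normrM normfV n2L (le_trans _ bL)//.
      by rewrite ler_wpM2l// lef_pV2 ?posrE ?mulr_gt0// ler_peMl ?(ltW L0)// ler1n.
    by rewrite normrM nr.
  have q3 : `|D ^+ 2 / 2| <= K ^+ 2 * e / 2.
    rewrite normrM normrX n2 ler_pM2r// (le_trans (y := (K * e) ^+ 2))//.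
      by apply: lerXn2r; rewrite ?nnegrE ?normr_ge0// mulr_ge0.
    by rewrite exprMn ler_wpM2l ?sqr_ge0// expr2 ler_piMl.
  have ce : cb * e <= 1.
    apply: le_trans c1e; rewrite ler_wpM2r//; clear -c1p K0 c10; lra.
  have q2' : cb * e * (K * e) <= K * e by rewrite ler_piMl// mulr_ge0.
  rewrite /q (le_trans (ler_normD _ _))// (le_trans (lerD (ler_normD _ _) (lexx _)))//.
  apply: le_trans (lerD (lerD q1 q2) q3) _.
  have hc := mulr_ge0 (sqr_ge0 cb) e0; have hK := mulr_ge0 (sqr_ge0 K) e0.
  clear -q2' hc hK.
  lra.
clearbody p q; clear b2 bL Dr D0 wE.
have p4 : `|p| <= 4^-1.
  have : (cb + K) * e <= c1 * e by rewrite ler_wpM2r.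
  clear -pc c1e; lra.
have q4 : `|q| <= 4^-1.
  have : (cb ^+ 2 + 2 * K + K ^+ 2) * e <= c1 * e by rewrite ler_wpM2r.
  clear -qc c1e; lra.
have := p4; rewrite ler_norml => /andP[pl pu].
have w0 : 0 < w by rewrite wp mulr_gt0//; clear -pl; lra.
have wr : r / 2 <= w by rewrite wp ler_wpM2l ?(ltW r0)//; clear -pl; lra.
have winv : w ^- 2 <= 2 * e.
  apply: (@le_trans _ _ (2 / L)); last by rewrite ler_wpM2l.
  rewrite -[2 / L]invrK lef_pV2 ?posrE ?exprn_gt0 ?invr_gt0 ?divr_gt0//.
  have -> : (2 / L)^-1 = (r / 2) ^+ 2 by rewrite exprMn r2; field.
  by rewrite ler_sqr ?nnegrE ?divr_ge0 ?(ltW r0) ?(ltW w0).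
have winv1 : 0 <= w ^- 2 <= 1.
  rewrite invr_ge0 sqr_ge0/= (le_trans winv)//.
  have : 2 * e <= c1 * e by rewrite ler_wpM2r.
  have : 0 <= c1 * e by rewrite mulr_ge0.
  clear -c1e; lra.
have main : expR L * (gauss_density w / w) = expR (- t) * (expR (- q) / (1 + p)).
  rewrite gauss_densityE wq.
  have -> : - (L + b + q) = - L + (- b + - q) by ring.
  rewrite !expRD eb.
  have -> : Num.sqrt (4 * pi * L) = Num.sqrt (2 * pi) * r.
    rewrite -sqrtrM ?mulr_ge0 ?pi_ge0//; congr Num.sqrt; ring.
  have s0 : Num.sqrt (2 * pi) != 0 :> R by rewrite gt_eqF// (lt_le_trans ltr01 sqrt_2pi_ge1).
  have eL : expR L != 0 by rewrite gt_eqF// expR_gt0.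
  have p0 : 1 + p != 0 by rewrite gt_eqF//; clear -pl; lra.
  rewrite [in LHS]wp expRN; field.
  by rewrite s0 eL p0 r0'.
have [up lo] := exp_ratio_bounds p4 q4 winv1.
have tot : 4 * (`|p| + `|q| + w ^- 2) <= 12 * c1 * e.
  have hp : `|p| <= c1 * e by rewrite (le_trans pc)// ler_wpM2r.
  have hq : `|q| <= c1 * e by rewrite (le_trans qc)// ler_wpM2r.
  have hw : w ^- 2 <= c1 * e by rewrite (le_trans winv)// ler_wpM2r.
  clear -hp hq hw; lra.
have te := expR_ge0 (- t).
split.
- exact: w0.
- by rewrite wp mulrC ler_wpM2r ?(ltW r0)//; clear -pu; lra.
- apply: (@le_trans _ _ (expR (- t) * (12 * c1 * e))); last first.
    by have := mulr_ge0 c20 e0; clear; lra.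
  have up' : expR L * normal_cdf (- w) <= expR (- t) * (1 + 12 * c1 * e).
    apply: (@le_trans _ _ (expR L * (gauss_density w / w))).
      by rewrite ler_wpM2l ?expR_ge0// normal_tail_le.
    by rewrite main ler_wpM2l// (le_trans up)// lerD2l.
  have lo' : expR (- t) * (1 - 12 * c1 * e) <= expR L * normal_cdf (- w).
    apply: (@le_trans _ _ (expR L * (gauss_density w / w * (1 - w ^- 2)))); last first.
      by rewrite ler_wpM2l ?expR_ge0// normal_tail_ge.
    rewrite [leRHS]mulrA main -[leRHS]mulrA; apply: ler_wpM2l => //.
    by apply: le_trans lo; rewrite lerD2l lerN2.
  rewrite ler_norml; clear -up' lo'; apply/andP; split; lra.
have -> : - (w ^+ 2 / 3) = - (2 / 3 * L) + (2 / 3) * (- b) + (2 / 3) * (- q).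
  by rewrite (_ : w ^+ 2 / 3 = 2 / 3 * (w ^+ 2 / 2)); [rewrite wq; ring|field].
rewrite !expRD; set E := expR (- (2 / 3 * L)).
have E0 : 0 <= E by exact: expR_ge0.
(* Both signs of b are covered by e^(-2b/3) <= 1 + e^(-b). A bound linear in L suffices, since
   powers of L are later absorbed by n^(-1/6). *)
have h1 : expR (2 / 3 * - b) <= (1 + expR (- t) * (4 * pi)) * L.
  apply: (@le_trans _ _ (1 + expR (- b))).
    have [b0|b0] := leP (- b) 0.
      apply: (@le_trans _ _ 1); last by rewrite lerDl expR_ge0.
      by rewrite expR_le1 mulr_ge0_le0.
    apply: (@le_trans _ _ (expR (- b))); last by rewrite lerDr.
    by rewrite ler_expR ler_piMl ?(ltW b0)// ler_pdivrMr// mul1r ler_nat.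
  have pL : 1 <= 4 * pi * L by rewrite -[leLHS]mulr1 ler_pM.
  have : Num.sqrt (4 * pi * L) <= 4 * pi * L.
    rewrite -[leRHS]ger0_norm ?(le_trans _ pL)// -sqrtr_sqr ler_wsqrtr//.
    by rewrite expr2 ler_peMr// (le_trans _ pL).
  by rewrite eb => h; rewrite [leRHS]mulrDl mul1r -[X in _ <= _ + X]mulrA; apply: lerD => //; apply: ler_wpM2l.
have h2 : expR (2 / 3 * - q) <= 2.
  have := q4; rewrite ler_norml => /andP[ql qu].
  rewrite mulrN -[leRHS]invrK expRN lef_pV2 ?posrE ?expR_gt0//.
  by apply: le_trans (expR_ge1Dx _); clear -ql; lra.
apply: (@le_trans _ _ (E * ((1 + expR (- t) * (4 * pi)) * L) * 2)).
  by rewrite ler_pM ?mulr_ge0 ?expR_ge0// ler_wpM2l.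
have : 0 <= 12 * expR (- t) * c1 * L * E by rewrite !mulr_ge0// ltW.
by rewrite /c2; clear; lra.
Unshelve. all: by end_near. Qed.

(** A player has at least n - 2 games in play, so this gives M >= L^5, which keeps the smoothing
    variance sigma^2 M / L^4 above 1. In the proof 1440 is 2 * 6!. *)
Lemma near_expR_ge : \forall L \near +oo, (L : R) ^+ 5 <= expR L - 2.
Proof.
near=> L; have L1 : 1440 <= L by near: L; exact: near_ge.
have L0 : 0 <= L := le_trans (ler0n _ _) L1.
have := @expR_ge1Dxn R L 5 L0.
rewrite (_ : 6`!%:R = 720 :> R) // => H.
have L11 : 1 <= L by move: L1; clear; lra.
have L5 : 1 <= L ^+ 5 by exact: exprn_ege1.
have : 2 * L ^+ 5 <= L ^+ 6 / 720.
  rewrite [L ^+ 6]exprS mulrAC; apply: ler_wpM2r; first exact: le_trans ler01 L5.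
  by move: L1; clear; lra.
by move: H L5; clear; lra.
Unshelve. all: by end_near. Qed.

(** The seventh power collects L^6 from the smoothing variance to the power -3/2 and one L from
    [gumbel_tail]; the exponential is n^(-1/6). *)
Lemma pow7_exp_le L : 1 <= L ->
  L ^+ 7 * expR (- (L / 6)) <= 8`!%:R * 6 ^+ 8 / L.
Proof.
move=> L1; have L0 : 0 < L by exact: lt_le_trans L1.
rewrite ler_pdivlMr// mulrAC -exprSr expRN ler_pdivrMr ?expR_gt0//.
have L60 : 0 <= L / 6 by rewrite divr_ge0// ltW.
have := @expR_ge1Dxn R (L / 6) 7 L60; move: (8`!%N) (fact_gt0 8) => f f0 H.
have {}H : (L / 6) ^+ 8 / f%:R <= expR (L / 6) by apply: le_trans H; rewrite lerDr.
rewrite -[leLHS](_ : f%:R * 6 ^+ 8 * ((L / 6) ^+ 8 / f%:R) = _).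
  by rewrite ler_wpM2l// mulr_ge0// exprn_ge0.
rewrite exprMn exprVn; field.
by rewrite pnatr_eq0 -lt0n.
Qed.

(** This is n times the price of replacing the half-line by a smooth function: beyond 2 sqrt(L)
    deviations the normal mass is at most e^(-2L) = n^-2. *)
Lemma near_small_tail : \forall L \near +oo,
  expR L * normal_cdf (- (2 * Num.sqrt L)) <= rate L.
Proof.
near=> L; have L1 : 1 <= L by near: L; exact: near_ge.
have lnL : 1 <= ln L by near: L; exact: near_ln_ge.
have L0 : 0 < L by exact: lt_le_trans L1.
apply: (le_trans _ (inv_le_rate L1 lnL)).
have s1 : 1 <= Num.sqrt L by rewrite -[leLHS]sqrtr1 ler_wsqrtr.
have v1 : 1 <= 2 * Num.sqrt L by lra.
have v0 : 0 < 2 * Num.sqrt L by exact: lt_le_trans v1.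
apply: (@le_trans _ _ (expR L * expR (- (2 * L)))).
  rewrite ler_wpM2l ?expR_ge0// (le_trans (normal_tail_le v0))//.
  rewrite ler_pdivrMr// (le_trans (gauss_density_le _))//.
  rewrite exprMn sqr_sqrtr ?(ltW L0)//.
  rewrite (_ : 2 ^+ 2 * L / 2 = 2 * L); last by field.
  by rewrite ler_peMr ?expR_ge0.
rewrite -expRD (_ : L + _ = - L) ?expRN; last by ring.
rewrite lef_pV2 ?posrE ?expR_gt0//.
by apply: le_trans (expR_ge1Dx L); rewrite lerDr.
Unshelve. all: by end_near. Qed.

(* [M] is the number of games of a player. Smoothing with a relative variance
   [L ^- 4] moves the normalized threshold by [O(rate L / Num.sqrt L)] only. *)
Definition smoothing_var sigma L M : R := sigma ^+ 2 * M / L ^+ 4.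

Definition total_var sigma L M : R := smoothing_var sigma L M + sigma ^+ 2 * M.

(** [expR L - 1] is n - 1: the normalization stays that of the full score even when a game has been
    removed. The shift [v] gathers a displacement of at most 1 and the widening due to smoothing. *)
Definition threshold t sigma L v : R :=
  Num.sqrt (expR L - 1) * sigma * level t L + v.

(* The minimizer of [theta |-> - theta * z + 3 / 4 * theta ^+ 2 * V], the
   exponent of the error term in [lindeberg]. *)
Definition tilt z V : R := 2 / 3 * (z / Num.sqrt V) / Num.sqrt V.

(** The normalized threshold is w = rho x + v/sqrt(V), where x is the level. Here |rho - 1| <= 2/L^2
    contributes 8/L to |w - x| r and the shift contributes (4 + 2/sigma)/L, so [gumbel_tail] applies
    with K = 12 + 2/sigma. Its instance K = 0 is used first, for the bound x <= 2r. *)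
Lemma tail_parameters_at t sigma (C1 C2 : R) L M v : 0 < sigma ->
  (forall w, `|w - level t L| * Num.sqrt (2 * L) <= 0 * rate L ->
  [/\ 0 < w, w <= 2 * Num.sqrt (2 * L),
    `|expR L * normal_cdf (- w) - expR (- t)| <= C2 * rate L &
    expR (- (w ^+ 2 / 3)) <= C2 * L * expR (- (2 / 3 * L))]) ->
  (forall w, `|w - level t L| * Num.sqrt (2 * L) <= (12 + 2 / sigma) * rate L ->
  [/\ 0 < w, w <= 2 * Num.sqrt (2 * L),
    `|expR L * normal_cdf (- w) - expR (- t)| <= C1 * rate L &
    expR (- (w ^+ 2 / 3)) <= C1 * L * expR (- (2 / 3 * L))]) ->
  L ^+ 5 <= expR L - 2 -> 4 <= L -> 64 / sigma <= L -> sigma ^- 2 <= L ->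
  1 <= ln L -> expR L - 2 <= M -> M <= expR L - 1 ->
  `|v| <= 1 + 2 * Num.sqrt L * Num.sqrt (smoothing_var sigma L M) ->
  let C3 := 240 * `|C1| / sigma ^+ 3 * (8`!%:R * 6 ^+ 8) in
  let tau0 := smoothing_var sigma L M in
  let V := total_var sigma L M in
  let z := threshold t sigma L v in
  [/\ 1 <= tau0, 0 <= tilt z V <= 8^-1,
    `|expR L * normal_cdf (- (z / Num.sqrt V)) - expR (- t)| <= (`|C1| + C3) * rate L &
    expR L * (M * (60 / Num.sqrt tau0 ^+ 3 *
      expR (tilt z V - tilt z V * z + 3 / 4 * tilt z V ^+ 2 * V))) <= (`|C1| + C3) * rate L].
Proof.
move=> s0 lev gum L5 L1 Ls Ls2 lnL M1 M2.
rewrite /tilt /threshold /total_var /smoothing_var /=.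
set C3 := _ * (_ * 6 ^+ 8); set tau0 := _ / L ^+ 4 => vb.
set V := tau0 + _; set z := _ + v.
set w := z / _; set theta := _ / Num.sqrt V.
have is0 : 0 < sigma^-1 by rewrite invr_gt0.
have K0 : 0 <= 12 + 2 / sigma by rewrite addr_ge0// divr_ge0// ltW.
have L0 : 0 < L by exact: lt_le_trans L1.
have L1' : 1 <= L by apply: le_trans L1; rewrite ler1n.
have Linv := inv_le_rate L1' lnL.
set e := rate L in gum lev Linv *.
have e0 : 0 <= e by rewrite (le_trans _ Linv)// invr_ge0 ltW.
set x := level t L in gum lev z w theta *.
set r := Num.sqrt (2 * L) in gum lev *.
have r2 : r ^+ 2 = 2 * L by rewrite sqr_sqrtr// mulr_ge0// ltW.
have r0 : 0 < r by rewrite sqrtr_gt0 mulr_gt0.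
have [x0 xr _ _] : [/\ 0 < x, x <= 2 * r, `|expR L * normal_cdf (- x) - expR (- t)| <= C2 * e &
    expR (- (x ^+ 2 / 3)) <= C2 * L * expR (- (2 / 3 * L))].
  by apply: lev; rewrite subrr normr0 !mul0r.
have M5 : L ^+ 5 <= M by exact: le_trans M1.
have M0 : 0 < M by apply: lt_le_trans M5; rewrite exprn_gt0.
set m := Num.sqrt M; have m0 : 0 < m by rewrite sqrtr_gt0.
have m2 : m ^+ 2 = M by rewrite sqr_sqrtr// ltW.
pose s := sigma * m; have ss0 : 0 < s by rewrite mulr_gt0.
have s2 : s ^+ 2 = sigma ^+ 2 * M by rewrite exprMn m2.
have L0' : L != 0 by rewrite gt_eqF.
have sig0' : sigma != 0 by rewrite gt_eqF.
have m0' : m != 0 by rewrite gt_eqF.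
have tauE : tau0 = (s / L ^+ 2) ^+ 2 by rewrite /tau0 -s2; field.
have sqt : Num.sqrt tau0 = s / L ^+ 2.
  by rewrite tauE sqrtr_sqr ger0_norm// divr_ge0 ?exprn_ge0// ltW.
have tau1 : 1 <= tau0.
  rewrite /tau0 ler_pdivlMr ?exprn_gt0// mul1r.
  apply: (@le_trans _ _ (sigma ^+ 2 * L ^+ 5)); last by rewrite ler_wpM2l// exprn_ge0// ltW.
  rewrite [L ^+ 5]exprS mulrA ler_peMl ?exprn_ge0 ?(ltW L0)//.
  by rewrite mulrC -ler_pdivrMr ?exprn_gt0// div1r.
have tau0pos : 0 < tau0 by exact: lt_le_trans tau1.
have Vs : s ^+ 2 <= V by rewrite s2 /V lerDr ltW.
have V0 : 0 < V by apply: lt_le_trans Vs; rewrite exprn_gt0.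
set g := Num.sqrt V in w theta *; have g0 : 0 < g by rewrite sqrtr_gt0.
have g2 : g ^+ 2 = V by rewrite sqr_sqrtr// ltW.
have sg : s <= g by rewrite -[s]ger0_norm ?(ltW ss0)// -sqrtr_sqr ler_wsqrtr.
have g0' : g != 0 by rewrite gt_eqF.
set N1 := expR L - 1 in M2 z w theta *.
have N10 : 0 < N1 by exact: lt_le_trans M2.
pose rho := Num.sqrt N1 * sigma / g.
have rho0 : 0 <= rho by rewrite divr_ge0 ?mulr_ge0 ?sqrtr_ge0// ltW.
have wE : w = rho * x + v / g by rewrite /w /z /rho; field.
have L40 := exprn_gt0 4 L0.
have p1 : 0 < M * L ^+ 4 + M by rewrite addr_gt0// mulr_gt0.
have p2 : 0 < sigma ^+ 2 * M + sigma ^+ 2 * M * L ^+ 4.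
  by rewrite addr_gt0// !mulr_gt0// exprn_gt0.
have rho2 : rho ^+ 2 = N1 / (M + M / L ^+ 4).
  rewrite /rho !exprMn exprVn g2 sqr_sqrtr ?(ltW N10)// /V /tau0; field.
  by rewrite L0' !gt_eqF.
have Lm2 : M^-1 + L ^- 4 <= 2 / L ^+ 2.
  have h1 : M^-1 <= L ^- 2.
    by rewrite lef_pV2 ?posrE ?exprn_gt0// (le_trans _ M5)// ler_weXn2l.
  have h2 : L ^- 4 <= L ^- 2 by rewrite lef_pV2 ?posrE ?exprn_gt0// ler_weXn2l.
  by clear -h1 h2; lra.
(* Since rho + 1 >= 1, it is enough to bound rho^2 - 1, which is rational in M and L. *)
have rho1 : `|rho - 1| <= 2 / L ^+ 2.
  apply: (@le_trans _ _ `|rho ^+ 2 - 1|).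
    rewrite (_ : rho ^+ 2 - 1 = (rho - 1) * (rho + 1)); last by ring.
    by rewrite normrM ler_peMr// (@le_trans _ _ (rho + 1)) ?lerDr// ler_norm.
  have D0 : 0 < M + M / L ^+ 4 by rewrite addr_gt0// divr_gt0// exprn_gt0.
  apply: le_trans Lm2; rewrite rho2.
  rewrite (_ : N1 / _ - 1 = (N1 - M - M / L ^+ 4) / (M + M / L ^+ 4)); last first.
    by field; rewrite L0' gt_eqF.
  rewrite normrM normfV [X in _ / X]ger0_norm ?(ltW D0)// ler_pdivrMr//.
  have q0 : 0 <= M / L ^+ 4 by rewrite divr_ge0 ?exprn_ge0// ltW.
  apply: (@le_trans _ _ (1 + M / L ^+ 4)).
    by move: M1 M2 q0; rewrite /N1 ler_norml; clear; lra.
  rewrite (_ : (M^-1 + L ^- 4) * (M + M / L ^+ 4) =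
    1 + M / L ^+ 4 + (M^-1 + L ^- 4) * (M / L ^+ 4)); last by field; rewrite L0' gt_eqF.
  by rewrite lerDl mulr_ge0// addr_ge0// invr_ge0 ?exprn_ge0// ltW.
have rm : r / m <= 2 / L.
  rewrite -[leLHS]ger0_norm ?divr_ge0 ?(ltW r0) ?(ltW m0)// -sqrtr_sqr.
  rewrite -[leRHS]ger0_norm ?divr_ge0 ?(ltW L0)// -sqrtr_sqr ler_wsqrtr//.
  rewrite !exprMn !exprVn r2 m2 ler_pdivrMr// mulrAC ler_pdivlMr ?exprn_gt0//.
  apply: (@le_trans _ _ (2 ^+ 2 * L ^+ 5)); last by rewrite ler_wpM2l ?exprn_ge0.
  have L35 : L ^+ 3 <= L ^+ 5 by rewrite ler_weXn2l.
  have L30 : 0 <= L ^+ 3 by rewrite exprn_ge0// ltW.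
  rewrite (_ : 2 * L * L ^+ 2 = 2 * L ^+ 3); last by ring.
  by clear -L35 L30; lra.
have rs : r / s <= 2 / sigma / L.
  rewrite (_ : r / s = sigma^-1 * (r / m)); last first.
    by rewrite /s; field; rewrite sig0' m0'.
  rewrite (_ : 2 / sigma / L = sigma^-1 * (2 / L)); last first.
    by field; rewrite sig0' L0'.
  by rewrite ler_wpM2l ?(ltW is0).
have wlev : `|w - x| * r <= (12 + 2 / sigma) * e.
  apply: (@le_trans _ _ ((12 + 2 / sigma) / L)); last by rewrite ler_wpM2l.
  have -> : w - x = (rho - 1) * x + v / g by rewrite wE; ring.
  apply: (@le_trans _ _ (2 / L ^+ 2 * (2 * r) * r + `|v| / g * r)).
    rewrite -mulrDl ler_wpM2r ?(ltW r0)// (le_trans (ler_normD _ _))// lerD//.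
      by rewrite normrM ler_pM// ger0_norm// ltW.
    by rewrite normrM normfV (ger0_norm (ltW g0)).
  have -> : 2 / L ^+ 2 * (2 * r) * r = 8 / L.
    rewrite (_ : 2 / L ^+ 2 * (2 * r) * r = 4 * r ^+ 2 / L ^+ 2); last by field.
    by rewrite r2; field.
  have : `|v| / g * r <= (4 + 2 / sigma) / L; last first.
    by move=> h; rewrite (_ : (12 + 2 / sigma) / L = 8 / L + (4 + 2 / sigma) / L); [rewrite lerD2l|rewrite -mulrDl; congr (_ / _); ring].
  apply: (@le_trans _ _ ((1 + 2 * Num.sqrt L * (s / L ^+ 2)) * (r / s))).
    rewrite -mulrA ler_pM// ?mulr_ge0 ?invr_ge0 ?(ltW g0) ?(ltW r0)//.
      by rewrite -sqt.
    by rewrite mulrC ler_wpM2l ?(ltW r0)// lef_pV2 ?posrE.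
  rewrite mulrDl mul1r [leRHS]mulrDl [leRHS]addrC lerD//.
  have -> : 2 * Num.sqrt L * (s / L ^+ 2) * (r / s) = 2 * (Num.sqrt L * r) / L ^+ 2.
    by field; rewrite L0' gt_eqF.
  have : Num.sqrt L * r <= 2 * L.
    rewrite -r2 expr2 ler_wpM2r ?(ltW r0)// /r ler_wsqrtr//.
    by rewrite ler_peMl ?(ltW L0)// ler1n.
  move=> h; rewrite ler_pdivrMr ?exprn_gt0//.
  rewrite (_ : 4 / L * L ^+ 2 = 4 * L); last by field.
  by clear -h; lra.
have [w0 wr main small] := gum w wlev.
have thE : theta = 2 / 3 * w / g by [].
have th0 : 0 <= theta by rewrite thE divr_ge0 ?(ltW g0)// pmulr_rge0 ?ltW.
have th8 : theta <= 8^-1.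
  apply: (@le_trans _ _ (4 / 3 * (r / s))).
    have w0' : 0 <= 2 / 3 * w by rewrite pmulr_rge0 ?ltW.
    rewrite thE [leRHS]mulrA; apply: ler_pM => //; rewrite ?invr_ge0 ?(ltW g0)//.
      by clear -wr; lra.
    by rewrite lef_pV2 ?posrE.
  have : 2 / sigma / L <= 2 / 64.
    rewrite ler_pdivrMr//; clear -Ls; lra.
  by clear -rs; lra.
split.
- exact: tau1.
- by rewrite th0.
- rewrite (le_trans main)// mulrDl (@le_trans _ _ (`|C1| * e))//.
    by rewrite ler_wpM2r// ler_norm.
  by rewrite lerDl mulr_ge0// /C3 !mulr_ge0 ?exprn_ge0 ?invr_ge0 ?exprn_ge0// ltW.
have zE : z = w * g by rewrite /w divfK.
have -> : theta - theta * z + 3 / 4 * theta ^+ 2 * V = theta + - (w ^+ 2 / 3).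
  by rewrite zE -g2 thE; field.
have eth : expR theta <= 2.
  rewrite -[leRHS]invrK -[leLHS]invrK -expRN lef_pV2 ?posrE ?expR_gt0//.
  by apply: le_trans (expR_ge1Dx _); clear -th8; lra.
(* As n M tau0^(-3/2) = n L^6 / (sigma^3 sqrt(M)) and e^(-w^2/3) is at most |C1| L n^(-2/3), the
   bound n^(1/2) <= 2 sqrt(M) leaves L^7 n^(-1/6). The factor 240 is 60 * 2 * 2, from [heat_step],
   from e^theta <= 2 and from this last bound. *)
apply: (@le_trans _ _ (C3 * e)); last by rewrite ler_wpM2r// lerDr.
rewrite sqt expRD.
have em : expR (L / 2) <= 2 * m.
  rewrite -[leLHS]ger0_norm ?expR_ge0// -sqrtr_sqr -[leRHS]ger0_norm; last by rewrite mulr_ge0// ltW.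
  rewrite -[X in _ <= X]sqrtr_sqr ler_wsqrtr// exprMn m2 -expRM_natr divfK//.
  have : 5 <= expR L by apply: le_trans (expR_ge1Dx L); clear -L1; lra.
  by clear -M1; lra.
have h1 : expR theta * expR (- (w ^+ 2 / 3)) <= 2 * (`|C1| * L * expR (- (2 / 3 * L))).
  rewrite ler_pM ?expR_ge0// (le_trans small)// ler_wpM2r ?expR_ge0// ler_wpM2r ?(ltW L0)//.
  exact: ler_norm.
apply: (@le_trans _ _ (expR L * (M * (60 / (s / L ^+ 2) ^+ 3 *
    (2 * (`|C1| * L * expR (- (2 / 3 * L)))))))).
  rewrite ler_wpM2l ?expR_ge0// ler_wpM2l ?(ltW M0)// ler_wpM2l//.
  by rewrite divr_ge0// exprn_ge0// divr_ge0 ?exprn_ge0// ltW.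
have -> : expR L * (M * (60 / (s / L ^+ 2) ^+ 3 * (2 * (`|C1| * L * expR (- (2 / 3 * L)))))) =
    120 * `|C1| / sigma ^+ 3 * (L ^+ 7 * (expR L * expR (- (2 / 3 * L)) / m)).
  by rewrite /s -m2; field; rewrite L0' sig0' m0'.
have -> : expR L * expR (- (2 / 3 * L)) = expR (L / 2) * expR (- (L / 6)).
  by rewrite -!expRD; congr expR; field.
have h2 : expR (L / 2) * expR (- (L / 6)) / m <= 2 * expR (- (L / 6)).
  by rewrite ler_pdivrMr// mulrAC ler_wpM2r ?expR_ge0.
apply: (@le_trans _ _ (120 * `|C1| / sigma ^+ 3 * (2 * (8`!%:R * 6 ^+ 8 * e)))).
  rewrite ler_wpM2l ?divr_ge0 ?mulr_ge0 ?exprn_ge0 ?(ltW s0)//.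
  apply: (@le_trans _ _ (2 * (L ^+ 7 * expR (- (L / 6))))).
    by rewrite [leRHS]mulrCA; apply: ler_wpM2l h2; rewrite exprn_ge0// ltW.
  by rewrite ler_wpM2l// (le_trans (pow7_exp_le L1'))// ler_wpM2l.
by rewrite /C3 le_eqVlt; apply/orP; left; apply/eqP; move: (8`!%N) => f; ring.
Qed.

(** [M] will be n - 1 for a full score and n - 2 when one game is removed; the range of [v] allows
    the displacement 1 plus 2 sqrt(L) smoothing deviations. *)
Definition tail_estimates t sigma (C : R) L := forall M v,
  expR L - 2 <= M -> M <= expR L - 1 ->
  `|v| <= 1 + 2 * Num.sqrt L * Num.sqrt (smoothing_var sigma L M) ->
  let tau0 := smoothing_var sigma L M in
  let V := total_var sigma L M in
  let z := threshold t sigma L v in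
  [/\ 1 <= tau0, 0 <= tilt z V <= 8^-1,
    `|expR L * normal_cdf (- (z / Num.sqrt V)) - expR (- t)| <= C * rate L &
    expR L * (M * (60 / Num.sqrt tau0 ^+ 3 *
      expR (tilt z V - tilt z V * z + 3 / 4 * tilt z V ^+ 2 * V))) <= C * rate L].

Lemma tail_parameters t sigma : 0 < sigma ->
  exists C, \forall L \near +oo, tail_estimates t sigma C L.
Proof.
move=> s0.
have K0 : 0 <= 12 + 2 / sigma by rewrite addr_ge0// divr_ge0// ltW.
have [C1 H1] := gumbel_tail t K0.
have [C2 H2] := gumbel_tail t (lexx 0).
exists (`|C1| + 240 * `|C1| / sigma ^+ 3 * (8`!%:R * 6 ^+ 8)).
near=> L; move=> M v M1 M2 vb.
apply: (@tail_parameters_at t sigma C1 C2 L M v) => //; near: L.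
- exact: H2.
- exact: H1.
- exact: near_expR_ge.
- exact: near_ln_ge.
Unshelve. all: by end_near. Qed.

End gumbel_asymptotics.

(** * From smoothed to sharp tail probabilities *)

Section score_tails.
Context (R : realType) (D : set R) (nu : probability R R).
Hypothesis hnu : reward_law D nu.
Context (n : nat) d (T : measurableType d) (P : probability T R).
Context (X : 'I_n -> 'I_n -> {RV P >-> R}).
Hypothesis hX : tournament D nu X.
Context (mu sigma : R).
Hypothesis hmu : forall i k, i != k -> ('E_P[X i k] = mu%:E)%E.
Hypothesis hsigma : forall i k, i != k -> sigma = Num.sqrt (fine ('V_P[X i k])%E).
Implicit Types (i k : 'I_n) (s : seq 'I_n) (w : T).

Definition tail_prob i s z : R :=
  mean P (fun w => (z < centered_sum X mu i s w)%R%:R).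

Lemma bdd_mfun_tail i s z : i \notin s ->
  bdd_mfun (fun w => (z < centered_sum X mu i s w)%R%:R : R).
Proof.
move=> is_; apply: (determined_bdd_mfun hnu hX (J := games_against i s)).
  apply: (determined_comp (fun x : R => (z < x)%R%:R)).
  exact: (determined_centered_sum hX).
exact: bdd_natr.
Qed.

Lemma bdd_mfun_smooth i s z tau : i \notin s ->
  bdd_mfun (fun w => normal_cdf ((centered_sum X mu i s w - z) / Num.sqrt tau)).
Proof.
move=> is_; apply: (determined_bdd_mfun hnu hX (J := games_against i s)).
  apply: (determined_comp (fun x : R => normal_cdf ((x - z) / Num.sqrt tau))).
  exact: (determined_centered_sum hX).
exact: bdd_normal_cdf.
Qed.

(** Where the sum exceeds z, the smooth function centered at z - eta is at least 1 minus the normal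
    tail beyond eta/sqrt(tau). *)
Lemma tail_le_smooth i s z eta tau : i \notin s -> 0 < tau ->
  tail_prob i s z <=
  mean P (fun w => normal_cdf ((centered_sum X mu i s w - (z - eta)) / Num.sqrt tau))
  + normal_cdf (- (eta / Num.sqrt tau)).
Proof.
move=> is_ tau0; have s0 : 0 < Num.sqrt tau by rewrite sqrtr_gt0.
have bs := bdd_mfun_smooth (z - eta) tau is_.
have bc : bdd_mfun (fun _ : T => normal_cdf (- (eta / Num.sqrt tau))).
  by split; [exact: measurable_cst|exact: bdd_cst].
rewrite -[normal_cdf (- (eta / _))](mean_cst P) -meanD//; apply: mean_le.
- exact: bdd_mfun_tail.
- exact: bdd_mfunD.
move=> w; case: ltP => /= h; last by rewrite addr_ge0 ?normal_cdf_ge0.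
rewrite normal_cdfN addrC -addrA -[leLHS]addr0 lerD2l addrC subr_ge0.
apply: normal_cdf_nondecreasing; rewrite ler_pM2r ?invr_gt0//.
by clear -h; lra.
Qed.

Lemma smooth_le_tail i s z eta tau : i \notin s -> 0 < tau ->
  mean P (fun w => normal_cdf ((centered_sum X mu i s w - (z + eta)) / Num.sqrt tau))
  <= tail_prob i s z + normal_cdf (- (eta / Num.sqrt tau)).
Proof.
move=> is_ tau0; have s0 : 0 < Num.sqrt tau by rewrite sqrtr_gt0.
have bs := bdd_mfun_smooth (z + eta) tau is_.
have bc : bdd_mfun (fun _ : T => normal_cdf (- (eta / Num.sqrt tau))).
  by split; [exact: measurable_cst|exact: bdd_cst].
rewrite -[normal_cdf (- (eta / _))](mean_cst P) -meanD//; last exact: bdd_mfun_tail.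
apply: mean_le => //.
  by apply: bdd_mfunD => //; exact: bdd_mfun_tail.
move=> w; case: ltP => /= h.
  by rewrite (le_trans (normal_cdf_le1 _))// lerDl normal_cdf_ge0.
rewrite add0r; apply: normal_cdf_nondecreasing.
rewrite -mulNr ler_pM2r ?invr_gt0//.
by clear -h; lra.
Qed.

(** In 2C + 1, one C comes from the normal tail at the shifted threshold, one from the replacement
    error, and 1 from the smoothing. *)
Lemma tail_prob_estimate t (C : R) i s c : (0 < n)%N ->
  tail_estimates t sigma C (ln n%:R) ->
  1 <= ln n%:R :> R ->
  n%:R * normal_cdf (- (2 * Num.sqrt (ln n%:R))) <= rate (ln n%:R) :> R ->
  uniq s -> i \notin s -> n%:R - 2 <= (size s)%:R :> R -> (size s)%:R <= n%:R - 1 :> R ->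
  `|c| <= 1 ->
  `|n%:R * tail_prob i s (Num.sqrt (n%:R - 1) * sigma * gumbel_scale t n + c)
    - expR (- t)| <= (2 * C + 1) * rate (ln n%:R).
Proof.
move=> n0 est L1 small us is_ s1 s2 c1.
set L := ln n%:R in est L1 small *.
have en : expR L = n%:R by rewrite lnK// posrE ltr0n.
set M : R := (size s)%:R in s1 s2.
have L0 : 0 < L by exact: lt_le_trans L1.
pose tau0 := smoothing_var sigma L M.
(* Chosen so that eta/sqrt(tau0) = 2 sqrt(L), the point at which the normal tail is known to be
   negligible. *)
pose eta := 2 * Num.sqrt L * Num.sqrt tau0.
have eta0 : 0 <= eta by rewrite !mulr_ge0 ?sqrtr_ge0.
pose V := total_var sigma L M.
pose err z := M * (60 / Num.sqrt tau0 ^+ 3 * expR (tilt z V - tilt z V * z + 3 / 4 * tilt z V ^+ 2 * V)).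
have key v : `|v| <= 1 + eta -> let z := threshold t sigma L v in
  [/\ 1 <= tau0, `|n%:R * normal_cdf (- (z / Num.sqrt V)) - expR (- t)| <= C * rate L,
    n%:R * err z <= C * rate L &
    `|mean P (fun w => normal_cdf ((centered_sum X mu i s w - z) / Num.sqrt tau0)) -
      normal_cdf (- (z / Num.sqrt V))| <= err z].
  move=> vb z; have := est M v; rewrite en => /(_ s1 s2 vb) [h1 h2 h3 h4].
  split => //; have := @lindeberg _ _ _ hnu _ _ _ _ _ hX _ _ hmu hsigma tau0 (tilt z V) z i s tau0 h1 h2 us is_ (lexx _).
  by rewrite mulNr.
have thr v : threshold t sigma L (c + v) =
    Num.sqrt (n%:R - 1) * sigma * gumbel_scale t n + c + v.
  by rewrite /threshold en addrA.
set z0 := _ + c; have vb1 : `|c - eta| <= 1 + eta.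
  by rewrite (le_trans (ler_normB _ _))// lerD// ger0_norm.
have vb2 : `|c + eta| <= 1 + eta.
  by rewrite (le_trans (ler_normD _ _))// lerD// ger0_norm.
have [t1 a1 e1 l1] := key _ vb1; have [_ a2 e2 l2] := key _ vb2.
have tau0pos : 0 < tau0 by exact: lt_le_trans t1.
have eq2 : eta / Num.sqrt tau0 = 2 * Num.sqrt L.
  by rewrite /eta mulfK// gt_eqF// sqrtr_gt0.
have up := tail_le_smooth z0 eta is_ tau0pos.
have lo := smooth_le_tail z0 eta is_ tau0pos.
move: l1 l2 a1 a2 e1 e2; rewrite !thr -/z0.
rewrite eq2 in up lo.
set m1 := mean P _ in up *; set m2 := mean P _ in lo *.
set q := normal_cdf (- (2 * _)) in up lo small.
set tp := tail_prob _ _ _ in up lo *.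
set p1 := normal_cdf _; set p2 := normal_cdf _; set r1 := err _; set r2 := err _.
set K := C * rate L; set rr := rate L in small *.
rewrite !ler_norml => /andP[_ l1] /andP[l2 _] /andP[_ a1] /andP[a2 _] e1 e2.
have nn : 0 <= n%:R :> R by [].
have up' : n%:R * tp <= n%:R * (p1 + r1 + q).
  by rewrite ler_wpM2l//; clear -up l1; lra.
have lo' : n%:R * (p2 - r2 - q) <= n%:R * tp.
  by rewrite ler_wpM2l//; clear -lo l2; lra.
rewrite (_ : (2 * C + 1) * rr = 2 * K + rr); last by rewrite /K -/rr; ring.
clearbody K rr p1 p2 r1 r2 q tp m1 m2.
by clear -up' lo' a1 a2 e1 e2 small; apply/andP; split; lra.
Qed.

End score_tails.

(** * Poisson approximation *)

Section poisson_stein.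
Context {R : realType}.
Variable lam : R.
Hypothesis lam0 : 0 < lam.

Let a (i : nat) : R := lam ^+ i / i`!%:R.

Let fact_pos (i : nat) : 0 < i`!%:R :> R.
Proof. by rewrite ltr0n fact_gt0. Qed.

Let a_gt0 i : 0 < a i.
Proof. by rewrite divr_gt0// exprn_gt0. Qed.

Let a_succ i : i.+1%:R * a i.+1 = lam * a i.
Proof.
rewrite /a factS natrM exprS; field.
by rewrite gt_eqF//= nat1r pnatr_eq0.
Qed.

Let a_add k r : a (k + r) <= a k * a r.
Proof.
rewrite /a exprD [leRHS]mulrACA -invfM -natrM ler_wpM2l ?mulr_ge0 ?exprn_ge0 ?(ltW lam0)//.
rewrite lef_pV2 ?posrE ?ltr0n ?muln_gt0 ?fact_gt0// ler_nat.
have -> : (k + r)`! = ('C(k + r, k) * (k`! * r`!))%N.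
  by rewrite -(bin_fact (leq_addr r k)) addKn.
by rewrite leq_pmull// bin_gt0 leq_addr.
Qed.

Let psum_le N : \sum_(0 <= i < N) a i <= expR lam.
Proof.
have -> : \sum_(0 <= i < N) a i = series (exp_coeff lam) N by [].
apply: nondecreasing_cvgn_le; last exact: is_cvg_series_exp_coeff.
by apply: nondecreasing_series => i _ _; rewrite /exp_coeff /= divr_ge0// exprn_ge0// ltW.
Qed.

(** Since k! r! <= (k+r)!, the terms satisfy a_(k+r) <= a_k a_r, so the tail from k is at most its
    first term times the whole exponential series. *)
Let tail_le k : expR lam - \sum_(0 <= i < k) a i <= a k * expR lam.
Proof.
rewrite lerBlDl; apply: limr_le; first exact: is_cvg_series_exp_coeff.
near=> N; have kN : (k <= N)%N by near: N; exact: nbhs_infty_ge.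
rewrite /series /= (@big_cat_nat _ _ _ k)//= lerD2l.
rewrite -{1}[k]add0n big_addn.
apply: (@le_trans _ _ (\sum_(0 <= i < N - k) a k * a i)).
  by apply: ler_sum => i _; rewrite addnC; exact: a_add.
by rewrite -mulr_sumr ler_wpM2l// ltW.
Unshelve. all: by end_near. Qed.

(** The recursion is solved by partial sums of h_i a_i, where h is the centered indicator of i <= j.
    The bound is crude but depends only on lam and j: finitely many values for k <= j, and the
    exponential tail estimate for k > j. *)
Lemma poisson_stein (j : nat) :
  let L := expR (- lam) * \sum_(0 <= i < j.+1) a i in
  exists (g : nat -> R) (M : R), (forall k, `|g k| <= M) /\
    forall k, lam * g k.+1 - k%:R * g k = (k <= j)%N%:R - L.
Proof.
move=> L; pose h i : R := (i <= j)%N%:R - L.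
(* At k = 0 the quotient is 0/0 = 0; this value enters the equation only with the factor 0. *)
pose g k := (\sum_(0 <= i < k) h i * a i) / (k%:R * a k).
have L0 : 0 <= L.
  by rewrite mulr_ge0 ?expR_ge0// sumr_ge0// => i _; exact: ltW.
exists g, (\sum_(0 <= i < j.+1) a i + \sum_(0 <= k < j.+1) `|g k|); split; last first.
  move=> k; have ak := gt_eqF (a_gt0 k).
  have -> : lam * g k.+1 = (\sum_(0 <= i < k.+1) h i * a i) / a k.
    by rewrite /g a_succ; field; rewrite ak gt_eqF.
  have -> : k%:R * g k = (\sum_(0 <= i < k) h i * a i) / a k.
    rewrite /g; case: k ak => [|k] ak; first by rewrite big_geq// !mul0r.
    by field; rewrite ak nat1r pnatr_eq0.
  by rewrite big_nat_recr//= -mulrBl [X in X - _]addrC addrK mulfK// ak.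
move=> k; have [kj|jk] := leqP k j.
  apply: (@le_trans _ _ (\sum_(0 <= k < j.+1) `|g k|)); last first.
    by rewrite lerDr sumr_ge0// => i _; exact: ltW.
  rewrite (bigD1_seq k) ?iota_uniq ?mem_index_iota//=.
  by rewrite lerDl sumr_ge0.
apply: (@le_trans _ _ (\sum_(0 <= i < j.+1) a i)); last by rewrite lerDl sumr_ge0.
have LE : L * expR lam = \sum_(0 <= i < j.+1) a i.
  by rewrite /L mulrAC -expRD addNr expR0 mul1r.
(* Past j the indicator contributes its full sum L e^lam, so the partial sum is L times the
   remaining tail of the series. *)
have num : \sum_(0 <= i < k) h i * a i = L * (expR lam - \sum_(0 <= i < k) a i).
  rewrite mulrBr LE mulr_sumr -[RHS]addr0.
  under eq_bigr do rewrite /h mulrBl.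
  rewrite sumrB addr0; congr (_ - _).
  rewrite (@big_cat_nat _ _ _ j.+1)//= [X in _ + X]big_nat_cond [X in _ + X]big1 ?addr0.
    rewrite big_nat_cond [RHS]big_nat_cond; apply: eq_bigr => i.
    by rewrite andbT /= ltnS => ->; rewrite mul1r.
  by move=> i; rewrite andbT => /andP[ji _]; rewrite leqNgt ji mul0r.
have k0 : (0 < k)%N by exact: leq_ltn_trans jk.
have k1 : 1 <= k%:R :> R by rewrite ler1n.
have tk0 : 0 <= expR lam - \sum_(0 <= i < k) a i by rewrite subr_ge0.
have ka0 : 0 < k%:R * a k by rewrite mulr_gt0// ltr0n.
rewrite /g num ger0_norm; last by rewrite divr_ge0 ?(ltW ka0)// mulr_ge0.
rewrite ler_pdivrMr; last by rewrite mulr_gt0// ltr0n.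
rewrite -LE -[leRHS]mulrA; apply: ler_wpM2l => //.
apply: (le_trans (tail_le k)); rewrite mulrC; apply: ler_wpM2l; first exact: expR_ge0.
by rewrite ler_peMl// ltW.
Qed.

End poisson_stein.

(** Rank n - j, counted from 1, sits at position n - j - 1 of the sorted list; its entry is at most
    x exactly when at least n - j entries are. *)
Lemma order_stat_le (R : realType) (n : nat) (s : 'I_n -> R) (j : nat) (x : R) :
  (j < n)%N ->
  (order_stat s (n - j) <= x) = (\sum_(i < n) (x < s i)%R <= j)%N.
Proof.
move=> jn; rewrite /order_stat; set u := [seq s i | i <- enum 'I_n].
set v := sort _ u; have sv : sorted <=%O v by exact: sort_le_sorted.
have szv : size v = n by rewrite size_sort size_map size_enum_ord.
have cnt : (\sum_(i < n) (x < s i)%R = n - count (<= x) v)%N.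
  have <- : count (> x) v = (\sum_(i < n) (x < s i)%R)%N.
    rewrite (permP (permEl (perm_sort _ _))) /u count_map -sum1_count big_mkcond.
    by rewrite big_enum; apply: eq_bigr => i _ /=; case: ifP.
  rewrite -szv -(count_predC (<= x) v) addKn; apply: eq_count => y /=.
  by rewrite ltNge.
have pn : ((n - j).-1 < n)%N by rewrite prednK ?leq_subr// subn_gt0.
rewrite cnt leq_subLR addnC -leq_subLR -(prednK (n := n - j)) ?subn_gt0//.
apply/idP/idP => [le|lt]; last exact: nth_count_le.
rewrite ltnNge; apply/negP => ge.
have := @nth_count_gt _ _ x 0 v _ sv; move=> /(_ (n - j).-1).
by rewrite ge szv pn => /(_ isT); rewrite ltNge le.
Qed.

(** * Stein-Chen bound for the number of exceedances *)

Section poisson_approximation.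
Context (R : realType) (D : set R) (nu : probability R R).
Hypothesis hnu : reward_law D nu.
Context (n : nat) d (T : measurableType d) (P : probability T R).
Context (X : 'I_n -> 'I_n -> {RV P >-> R}).
Hypothesis hX : tournament D nu X.
Context (mu : R).
Implicit Types (i k : 'I_n) (s : seq 'I_n) (w : T).

Definition opponents i : seq 'I_n := [seq k <- enum 'I_n | k != i].

(** Used as the opponents of [k] from which [i] has been removed. *)
Definition opponents_but i k : seq 'I_n :=
  [seq l <- enum 'I_n | (l != k) && (l != i)].

Lemma opponents_uniq i : uniq (opponents i).
Proof. by rewrite filter_uniq// enum_uniq. Qed.

Lemma opponents_but_uniq i k : uniq (opponents_but i k).
Proof. by rewrite filter_uniq// enum_uniq. Qed.

Lemma opponentsP i : i \notin opponents i.
Proof. by rewrite mem_filter eqxx. Qed.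

Lemma opponents_butP i k : k \notin opponents_but i k.
Proof. by rewrite mem_filter eqxx. Qed.

Lemma size_opponents i : size (opponents i) = n.-1.
Proof.
have := count_predC (pred1 i) (enum 'I_n).
rewrite size_enum_ord count_uniq_mem ?enum_uniq// mem_enum /= add1n size_filter.
by move=> /(congr1 predn) /= <-.
Qed.

Lemma size_opponents_but i k : k != i -> size (opponents_but i k) = n.-2.
Proof.
move=> ki.
have -> : opponents_but i k = [seq l <- opponents k | l != i].
  by rewrite /opponents -filter_predI; apply: eq_filter => l /=; rewrite andbC.
have := count_predC (pred1 i) (opponents k).
rewrite size_opponents count_uniq_mem ?opponents_uniq// mem_filter eq_sym ki mem_enum /=.
by rewrite size_filter add1n => /(congr1 predn) /= <-.
Qed.

Lemma centered_sum_opponents i w :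
  centered_sum X mu i (opponents i) w = \sum_(k < n | k != i) (X i k w - mu).
Proof. by rewrite /centered_sum big_filter big_enum_cond. Qed.

Lemma centered_sum_split i k w : k != i ->
  centered_sum X mu k (opponents k) w =
  centered_sum X mu k (opponents_but i k) w + (X k i w - mu).
Proof.
move=> ki; rewrite centered_sum_opponents (bigD1 i) 1?eq_sym//= addrC.
by rewrite /centered_sum big_filter big_enum_cond.
Qed.

Lemma score_opponents i w : (0 < n)%N ->
  score (fun i j => X i j : T -> R) w i - n.-1%:R * mu =
  centered_sum X mu i (opponents i) w.
Proof.
move=> n0; rewrite /centered_sum sumrB big_filter big_enum_cond; congr (_ - _).
by rewrite big_const_seq count_predT size_opponents iter_addr_0 mulr_natl.
Qed.

Context (z : R).

Definition exceeds i w : bool := z < centered_sum X mu i (opponents i) w.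

Definition count_exceeds w : nat := (\sum_(i < n) exceeds i w)%N.

(* As [X k i] lies in [0, 1], [exceeds k] is squeezed between these two events,
   neither of which involves player [i]. *)
Let below i k w : bool := z + mu < centered_sum X mu k (opponents_but i k) w.

Let above i k w : bool := z + mu - 1 < centered_sum X mu k (opponents_but i k) w.

Let below_exceeds i k w : k != i -> below i k w -> exceeds k w.
Proof.
move=> ki; rewrite /below /exceeds (centered_sum_split w ki) => h.
by have /andP[] := reward_bdd hnu hX w ki; lra.
Qed.

Let exceeds_above i k w : k != i -> exceeds k w -> above i k w.
Proof.
move=> ki; rewrite /above /exceeds (centered_sum_split w ki) => h.
by have /andP[] := reward_bdd hnu hX w ki; lra.
Qed.

Let V i w : nat := (\sum_(k < n | k != i) below i k w)%N.

Let W' i w : nat := (\sum_(k < n | k != i) exceeds k w)%N.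

(** This counts the players whose exceedance may hinge on their game against [i]. It dominates W' -
    V and, like V, does not involve the games of [i], so its product with the indicator of [i]
    factors in the mean. *)
Let gap i w : R := \sum_(k < n | k != i) ((above i k w)%:R - (below i k w)%:R).

Let countE i w : count_exceeds w = (exceeds i w + W' i w)%N.
Proof. by rewrite /count_exceeds (bigD1 i). Qed.

Let V_le i w : (V i w <= W' i w)%N.
Proof.
apply: leq_sum => k ki; have := @below_exceeds i k w ki.
by case: (below i k w) => // ->.
Qed.

Let W'_gap i w : (W' i w)%:R - (V i w)%:R <= gap i w.
Proof.
rewrite /W' /V !natr_sum -sumrB; apply: ler_sum => k ki; rewrite lerD2r ler_nat.
have := @exceeds_above i k w ki.
by case: (exceeds k w) => // ->.
Qed.

Let gap_ge0 i w : 0 <= gap i w.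
Proof. by apply: le_trans (W'_gap i w); rewrite subr_ge0 ler_nat. Qed.

Definition mean_gap i : R :=
  \sum_(k < n | k != i) (tail_prob X mu k (opponents_but i k) (z + mu - 1)
    - tail_prob X mu k (opponents_but i k) (z + mu)).

Let games_of i : {set 'I_n * 'I_n} := games_against i (opponents i).

Let games_without i : {set 'I_n * 'I_n} :=
  [set p : 'I_n * 'I_n | (p.1 != i) && (p.2 != i)]%SET.

Let games_disjoint i : {in games_of i, forall p, p \notin games_without i}.
Proof.
move=> p; rewrite !inE => /orP[/andP[/eqP -> _]|/andP[/eqP -> _]].
  by rewrite eqxx.
by rewrite eqxx andbF.
Qed.

Let games_but_sub i k : k != i ->
  (games_against k (opponents_but i k) \subset games_without i)%SET.
Proof.
move=> ki; apply/fintype.subsetP => p; rewrite !inE !mem_filter.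
by case/orP => /andP[/eqP -> /andP[/andP[_ ->] _]]; rewrite ki.
Qed.

Let determined_all J (C : Type) (f : T -> C) :
  determined_by X J f -> determined_by X [set: _]%SET f.
Proof. by apply: determinedS; exact: finset.subsetT. Qed.

Let determined_exceeds i : determined_by X (games_of i) (exceeds i).
Proof.
apply: (determined_comp (fun x => z < x)).
exact: (determined_centered_sum hX mu (opponentsP i)).
Qed.

Let determined_cmp i k (c : R) : k != i -> determined_by X (games_without i)
  (fun w => c < centered_sum X mu k (opponents_but i k) w).
Proof.
move=> ki; apply: (determined_comp (fun x => c < x)).
apply: (determinedS (games_but_sub ki)).
exact: (determined_centered_sum hX mu (opponents_butP i k)).
Qed.

Let determined_V i : determined_by X (games_without i) (V i).
Proof.
move=> w w' ww'; apply: eq_bigr => k ki.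
by rewrite /below (determined_cmp _ ki ww').
Qed.

Let determined_gap i : determined_by X (games_without i) (gap i).
Proof.
move=> w w' ww'; apply: eq_bigr => k ki.
by rewrite /below /above !(determined_cmp _ ki ww').
Qed.

Let determined_count : determined_by X [set: _]%SET count_exceeds.
Proof.
move=> w w' ww'; apply: eq_bigr => k _.
by rewrite (determined_all (@determined_exceeds k) ww').
Qed.

Let determined_W' i : determined_by X [set: _]%SET (W' i).
Proof.
move=> w w' ww'; apply: eq_bigr => k _.
by rewrite (determined_all (@determined_exceeds k) ww').
Qed.

Let bdd_gap i : bdd (gap i).
Proof. by apply: bdd_sum => k _; apply: bddB; exact: bdd_natr. Qed.

Let bmT J (f : T -> R) : determined_by X J f -> bdd f -> bdd_mfun f.
Proof. exact: (determined_bdd_mfun hnu hX). Qed.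

Let mean_gapE i : mean P (gap i) = mean_gap i.
Proof.
have bF k : bdd_mfun (fun w => if k != i then (above i k w)%:R - (below i k w)%:R else 0 : R).
  apply: (@bmT (games_without i)).
    move=> w w' ww'; case: ifP => // ki.
    by rewrite /below /above !(determined_cmp _ ki ww').
  by case: (k != i); [apply: bddB; exact: bdd_natr|exact: bdd_cst].
have [H _] := mean_sum P (index_enum 'I_n) bF.
rewrite /mean_gap big_mkcond /=.
have -> : gap i = (fun w => \sum_k (if k != i then (above i k w)%:R - (below i k w)%:R else 0 : R)).
  by apply/funext => w; rewrite /gap big_mkcond.
rewrite H; apply: eq_bigr => k _; case: ifP => ki; last exact: mean_cst.
by rewrite meanB//; apply: (bdd_mfun_tail hnu hX); exact: opponents_butP.
Qed.

Lemma mean_gap_ge0 i : 0 <= mean_gap i.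
Proof. by rewrite -mean_gapE; exact: mean_ge0. Qed.

Context (g : nat -> R) (M : R).
Hypothesis gM : forall m : nat, `|g m| <= M.

Let M0 : 0 <= M. Proof. exact: le_trans (normr_ge0 _) (gM 0%N). Qed.

(** Distinct integers differ by at least 1, so a function bounded by M is Lipschitz on them with
    constant 2M. *)
Let g_lipschitz (a b : nat) (c : R) : (a <= b)%N -> b%:R - a%:R <= c ->
  `|g b.+1 - g a.+1| <= 2 * M * c.
Proof.
move=> ab abc; have [E|ne] := eqVneq a b.
  rewrite E subrr normr0 mulr_ge0 ?mulr_ge0//.
  by apply: le_trans abc; rewrite subr_ge0 ler_nat.
have c1 : 1 <= c.
  apply: le_trans abc; rewrite -natrB// ler1n subn_gt0 ltn_neqAle ne ab.
  by [].
rewrite (le_trans (ler_normB _ _))//.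
apply: (@le_trans _ _ (2 * M)); first by rewrite mulr_natl mulr2n lerD.
by rewrite ler_peMr// mulr_ge0.
Qed.

Let bdd_g (f : T -> nat) : bdd (fun w => g (f w)).
Proof. by exists M => w; exact: gM. Qed.

(* Both means are compared with [p_i * mean (g (V_i + 1))], where the count [V_i]
   of the other players does not involve the games of player [i]. *)
Let step i (p := tail_prob X mu i (opponents i) z) :
  `|p * mean P (fun w => g (count_exceeds w).+1) -
    mean P (fun w => (exceeds i w)%:R * g (W' i w).+1)| <=
  p * (2 * M * (p + 2 * mean_gap i)).
Proof.
have dI := @determined_exceeds i.
have dIr : determined_by X (games_of i) (fun w => (exceeds i w)%:R : R).
  exact: (determined_comp (fun b : bool => b%:R : R) dI).
have dg := determined_gap (i := i).
have bI : bdd_mfun (fun w => (exceeds i w)%:R : R) by exact: bmT dIr (bdd_natr _ _).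
have bG : bdd_mfun (gap i) by exact: bmT dg (bdd_gap i).
have dgV : determined_by X (games_without i) (fun w => g (V i w).+1).
  exact: (determined_comp (fun m => g m.+1) (determined_V (i := i))).
have bgV : bdd_mfun (fun w => g (V i w).+1) by exact: bmT dgV (bdd_g _).
have bgC : bdd_mfun (fun w => g (count_exceeds w).+1).
  by apply: bmT (bdd_g _); exact: (determined_comp (fun m => g m.+1) determined_count).
have bIW : bdd_mfun (fun w => (exceeds i w)%:R * g (W' i w).+1).
  apply: (@bmT [set: _]%SET); last by apply: bddM; [exact: bdd_natr|exact: bdd_g].
  apply: (determined_comp2 (fun x m => x * g m.+1)); first exact: determined_all dIr.
  exact: determined_W'.
have bM (f h : T -> R) : bdd_mfun f -> bdd_mfun h -> bdd_mfun (fun w => f w * h w).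
  by move=> [mf bf] [mh bh]; split; [exact: measurable_funM|exact: bddM].
have bB (f h : T -> R) : bdd_mfun f -> bdd_mfun h -> bdd_mfun (fun w => f w - h w).
  by move=> [mf bf] [mh bh]; split; [exact: measurable_funB|exact: bddB].
have bc (c : R) : bdd_mfun (fun _ : T => c) by split; [exact: measurable_cst|exact: bdd_cst].
have p0 : 0 <= p by exact: mean_ge0.
have iV : mean P (fun w => (exceeds i w)%:R * g (V i w).+1) = p * mean P (fun w => g (V i w).+1).
  exact: (mean_mul_determined hnu hX (@games_disjoint i) dIr dgV (bdd_natr _ _) (bdd_g _)).
have iG : mean P (fun w => (exceeds i w)%:R * gap i w) = p * mean_gap i.
  rewrite -mean_gapE.
  exact: (mean_mul_determined hnu hX (@games_disjoint i) dIr dg (bdd_natr _ _) (bdd_gap i)).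
(* The total count exceeds V by the indicator of [i] plus W' - V, hence by at most the indicator
   plus the gap. *)
have s1 : `|mean P (fun w => g (count_exceeds w).+1) - mean P (fun w => g (V i w).+1)|
    <= 2 * M * (p + mean_gap i).
  rewrite -meanB//; apply: (@le_trans _ _ (mean P (fun w => 2 * M * ((exceeds i w)%:R + gap i w)))).
    apply: mean_norm_le.
    - exact: bB.
    - by apply: (bM) => //; exact: bdd_mfunD.
    - move=> w; apply: g_lipschitz.
        by rewrite (countE i) (leq_trans (V_le i w))// leq_addl.
      by rewrite (countE i) natrD -addrA lerD2l W'_gap.
  rewrite meanZ; last exact: bdd_mfunD.
  by rewrite meanD// mean_gapE.
have s2 : `|mean P (fun w => (exceeds i w)%:R * g (W' i w).+1) - p * mean P (fun w => g (V i w).+1)|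
    <= 2 * M * (p * mean_gap i).
  rewrite -iV -iG -meanB//; last exact: bM.
  rewrite -meanZ; last exact: bM.
  apply: mean_norm_le.
  - by apply: (bB) => //; exact: bM.
  - by apply: (bM) => //; exact: bM.
  - move=> w; rewrite -mulrBr; case: (exceeds i w); last by rewrite !mul0r normr0 mulr0.
    rewrite !mul1r; apply: g_lipschitz; [exact: V_le|exact: W'_gap].
set A := mean P _ in s1 *; set B := mean P _ in s2 *; set C := mean P _ in s1 s2.
have -> : p * A - B = p * (A - C) - (B - p * C) by ring.
apply: (le_trans (ler_normB _ _)); rewrite normrM (ger0_norm p0).
have s3 : p * `|A - C| <= p * (2 * M * (p + mean_gap i)) by rewrite ler_wpM2l.
have -> : p * (2 * M * (p + 2 * mean_gap i)) =
    p * (2 * M * (p + mean_gap i)) + 2 * M * (p * mean_gap i) by ring.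
exact: lerD s3 s2.
Qed.

(** Stein's equation is averaged at the random count. The parameter [lam] is kept separate from the
    mean of the count, and the first term of the bound pays for their difference. *)
Lemma stein_chen (lam L : R) (j : nat) :
  (forall m : nat, lam * g m.+1 - m%:R * g m = (m <= j)%N%:R - L) ->
  `|fine (P [set w | (count_exceeds w <= j)%N]) - L| <=
  M * `|lam - \sum_(i < n) tail_prob X mu i (opponents i) z| +
  \sum_(i < n) tail_prob X mu i (opponents i) z *
    (2 * M * (tail_prob X mu i (opponents i) z + 2 * mean_gap i)).
Proof.
move=> gE; pose p i := tail_prob X mu i (opponents i) z.
have bgC : bdd_mfun (fun w => g (count_exceeds w).+1).
  by apply: bmT (bdd_g _); exact: (determined_comp (fun m => g m.+1) determined_count).
have bIW i : bdd_mfun (fun w => (exceeds i w)%:R * g (W' i w).+1).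
  apply: (@bmT [set: _]%SET); last by apply: bddM; [exact: bdd_natr|exact: bdd_g].
  apply: (determined_comp2 (fun (x : bool) m => x%:R * g m.+1)); last exact: determined_W'.
  exact: determined_all (@determined_exceeds i).
have bc (c : R) : bdd_mfun (fun _ : T => c) by split; [exact: measurable_cst|exact: bdd_cst].
have bZ (c : R) (f : T -> R) : bdd_mfun f -> bdd_mfun (fun w => c * f w).
  by move=> [mf bf]; split; [exact: measurable_funM|apply: bddM => //; exact: bdd_cst].
have [Hsum bsum] := mean_sum P (index_enum 'I_n) bIW.
have bj : bdd_mfun (fun w => (count_exceeds w <= j)%N%:R : R).
  by apply: bmT (bdd_natr _ _); exact: (determined_comp (fun m => (m <= j)%N%:R) determined_count).
rewrite -mean_natr; last first.
  have := @determined_measurable _ _ _ hnu _ _ _ _ _ hX _ _ (fun w => (count_exceeds w <= j)%N) [set true]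
    (determined_comp (fun m => (m <= j)%N) determined_count).
  by congr (measurable _); apply/seteqP; split.
have -> : mean P (fun w => (count_exceeds w <= j)%N%:R) - L =
    lam * mean P (fun w => g (count_exceeds w).+1) -
    \sum_(i < n) mean P (fun w => (exceeds i w)%:R * g (W' i w).+1).
  rewrite -[L in LHS](mean_cst P) -meanB// -meanZ// -Hsum -meanB//; last exact: bZ.
  congr mean; apply/funext => w; rewrite -gE; congr (_ - _).
  (* W g(W) is the sum over players of their indicator times g(W), and where player i exceeds, W =
     W'_i + 1. *)
  rewrite {1}/count_exceeds natr_sum mulr_suml; apply: eq_bigr => i _.
  by rewrite (countE i); case: (exceeds i w); rewrite ?mul0r// add1n.
set A := mean P _.
have -> : lam * A - \sum_(i < n) mean P (fun w => (exceeds i w)%:R * g (W' i w).+1) =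
    (lam - \sum_(i < n) p i) * A +
    \sum_(i < n) (p i * A - mean P (fun w => (exceeds i w)%:R * g (W' i w).+1)).
  by rewrite sumrB mulrBl mulr_suml addrA subrK.
rewrite (le_trans (ler_normD _ _))// lerD//.
  rewrite normrM mulrC ler_wpM2r// /A -(mean_cst P M); exact: mean_norm_le.
rewrite (le_trans (ler_norm_sum _ _ _))// ler_sum// => i _; exact: step.
Qed.

End poisson_approximation.

Lemma sum_ord_div (R : realType) n (x : R) : (0 < n)%N -> \sum_(i < n) x / n%:R = x.
Proof.
by move=> n0; rewrite sumr_const card_ord -[_ *+ n]mulr_natr divfK// pnatr_eq0 -lt0n.
Qed.

(** * Explicit error bound for a fixed number of players *)

Section order_statistics.
Context (R : realType) (D : set R) (nu : probability R R).
Hypothesis hnu : reward_law D nu.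
Context (n : nat) d (T : measurableType d) (P : probability T R).
Context (X : 'I_n -> 'I_n -> {RV P >-> R}).
Hypothesis hX : tournament D nu X.
Context (mu sigma : R).
Hypothesis hmu : forall i k, i != k -> ('E_P[X i k] = mu%:E)%E.
Hypothesis hsigma : forall i k, i != k -> sigma = Num.sqrt (fine ('V_P[X i k])%E).

Lemma order_stat_cdfE (j : nat) (x : R) : (1 < n)%N -> (j < n)%N -> 0 < sigma ->
  order_stat_cdf X mu sigma (n - j) x =
  fine (P [set w | (count_exceeds X mu (Num.sqrt (n%:R - 1) * sigma * x) w <= j)%N]).
Proof.
move=> n1 jn s0; rewrite /order_stat_cdf; congr (fine (P _)).
have nE : n.-1%:R = n%:R - 1 :> R by rewrite -subn1 natrB// ltnW.
have d0 : 0 < Num.sqrt n.-1%:R * sigma.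
  by rewrite mulr_gt0// sqrtr_gt0 ltr0n -subn1 subn_gt0.
apply/seteqP; suff E w : ((order_stat (score (fun i k => X i k : T -> R) w) (n - j)
      - n.-1%:R * mu) / (Num.sqrt n.-1%:R * sigma) <= x) =
    (count_exceeds X mu (Num.sqrt (n%:R - 1) * sigma * x) w <= j)%N.
  by split => w /=; rewrite E.
rewrite ler_pdivrMr// lerBlDr order_stat_le//; congr (_ <= _)%N.
apply: eq_bigr => i _; congr nat_of_bool; rewrite /exceeds -score_opponents ?(ltnW n1)//.
by rewrite ltrBrDr mulrC nE.
Qed.

(** Each p_i is at most B/n, and B/n <= B rate because 1/n <= 1/ln n. In a gap the main terms
    e^(-t)/n of the two tails cancel, the shifts mu - 1 and mu both lying in [-1, 1]; this leaves 2
    C' rate, and the factor 2 of [stein_chen] makes it 4 C'. *)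
Lemma order_stat_cdf_estimate (t C M L : R) (g : nat -> R) (j : nat)
  (C' := `|2 * C + 1|) (B := expR (- t) + C') :
  (1 < n)%N -> (j < n)%N -> 0 < sigma ->
  (forall m : nat, `|g m| <= M) ->
  (forall m : nat, expR (- t) * g m.+1 - m%:R * g m = (m <= j)%N%:R - L) ->
  tail_estimates t sigma C (ln n%:R) ->
  1 <= ln n%:R :> R -> 1 <= ln (ln n%:R) :> R -> rate (ln n%:R) <= 1 :> R ->
  n%:R * normal_cdf (- (2 * Num.sqrt (ln n%:R))) <= rate (ln n%:R) :> R ->
  `|order_stat_cdf X mu sigma (n - j) (gumbel_scale t n) - L| <=
  (M * C' + B * (2 * M * (B + 4 * C'))) * rate (ln n%:R).
Proof.
move=> n1 jn s0 gM gE est L1 lnL1 e1 small.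
rewrite order_stat_cdfE//; set z := _ * gumbel_scale t n.
set e := rate (ln n%:R) in e1 small *.
have n0 : (0 < n)%N by exact: ltnW.
have nr0 : 0 < n%:R :> R by rewrite ltr0n.
have C'0 : 0 <= C' by exact: normr_ge0.
have M0 : 0 <= M := le_trans (normr_ge0 _) (gM 0%N).
have ne : n%:R^-1 <= e.
  apply: le_trans (inv_le_rate L1 lnL1); rewrite lef_pV2 ?posrE ?(lt_le_trans ltr01 L1)//.
  exact/ltW/ln_sublinear.
have e0 : 0 <= e by rewrite (le_trans _ ne)// invr_ge0 ltW.
have tail (i : 'I_n) s c : uniq s -> i \notin s ->
    ((size s == n.-1) || (size s == n.-2)) -> `|c| <= 1 ->
    `|n%:R * tail_prob X mu i s (z + c) - expR (- t)| <= C' * e.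
  move=> us is_ ss c1; apply: (@le_trans _ _ ((2 * C + 1) * e)); last first.
    by rewrite ler_wpM2r// ler_norm.
  apply: (tail_prob_estimate hnu hX hmu hsigma) => //.
    by case/orP: ss => /eqP ->; rewrite lerBlDr -natrD ler_nat; case: (n) n1 => [|[|m]]//= _; rewrite ?addn2 ?addn1.
  by case/orP: ss => /eqP ->; rewrite lerBrDr natr1 ler_nat; case: (n) n1 => [|[|m]].
have mu01 : 0 <= mu <= 1.
  by apply: (mu_itv hnu hX hmu (i := Ordinal n0) (k := Ordinal n1)).
pose p i := tail_prob X mu i (opponents i) z.
have pE i : `|n%:R * p i - expR (- t)| <= C' * e.
  rewrite /p -[z]addr0; apply: tail; rewrite ?opponents_uniq ?opponentsP ?size_opponents ?eqxx//.
  by rewrite normr0.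
have Ce : C' * e <= C' by rewrite ler_piMr.
have B0 : 0 <= B by rewrite addr_ge0 ?expR_ge0.
have pB i : p i <= B / n%:R.
  rewrite ler_pdivlMr// mulrC; have := pE i; rewrite ler_norml /B => /andP[_].
  by rewrite lerBlDl => h; rewrite (le_trans h)// lerD2l.
have p0 i : 0 <= p i by exact: mean_ge0.
have gap i : mean_gap X mu z i <= 2 * C' * e.
  have q k : k != i -> tail_prob X mu k (opponents_but i k) (z + mu - 1) -
      tail_prob X mu k (opponents_but i k) (z + mu) <= 2 * C' * e / n%:R.
    move=> ki; rewrite ler_pdivlMr// mulrC mulrBr.
    have h1 : `|n%:R * tail_prob X mu k (opponents_but i k) (z + (mu - 1)) - expR (- t)| <= C' * e.
      apply: tail; rewrite ?opponents_but_uniq ?opponents_butP ?size_opponents_but ?eqxx ?orbT//.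
      by case/andP: mu01 => m0 m1; rewrite ler_norml; apply/andP; split; lra.
    have h2 : `|n%:R * tail_prob X mu k (opponents_but i k) (z + mu) - expR (- t)| <= C' * e.
      apply: tail; rewrite ?opponents_but_uniq ?opponents_butP ?size_opponents_but ?eqxx ?orbT//.
      by case/andP: mu01 => m0 m1; rewrite ler_norml; apply/andP; split; lra.
    rewrite -addrA; move: h1 h2; rewrite !ler_norml => /andP[_ h1] /andP[h2 _].
    rewrite -mulrA mulr_natl mulr2n; move: h1 h2.
    set a := n%:R * _; set b := n%:R * _; set c := C' * e; set l := expR _ => h1 h2.
    by clear -h1 h2; move: h1 h2; rewrite -[a - b](subrKA l) => h1 h2; rewrite lerD// -opprB lerNl.
  rewrite /mean_gap; apply: (@le_trans _ _ (\sum_(k < n | k != i) 2 * C' * e / n%:R)).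
    by apply: ler_sum => k; exact: q.
  apply: (@le_trans _ _ (\sum_(k < n) 2 * C' * e / n%:R)).
    rewrite [leLHS]big_mkcond; apply: ler_sum => k _.
    by case: ifP => // _; rewrite divr_ge0 ?ler0n// (mulr_ge0 _ e0)// mulr_ge0.
  by rewrite sum_ord_div.
apply: (le_trans (stein_chen hnu hX mu z gM gE)); rewrite [leRHS]mulrDl; apply: lerD.
  rewrite -mulrA ler_wpM2l// -/p.
  have -> : expR (- t) - \sum_(i < n) tail_prob X mu i (opponents i) z =
      \sum_(i < n) ((expR (- t) - n%:R * p i) / n%:R).
    rewrite -[X in X - _ = _](sum_ord_div _ n0) -sumrB; apply: eq_bigr => i _.
    by rewrite [in RHS]mulrBl [n%:R * _]mulrC mulfK// gt_eqF.
  rewrite (le_trans (ler_norm_sum _ _ _))//.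
  apply: (@le_trans _ _ (\sum_(i < n) C' * e / n%:R)).
    apply: ler_sum => i _; rewrite normrM distrC normfV (ger0_norm (ltW nr0)).
    by rewrite ler_pM2r ?invr_gt0.
  by rewrite sum_ord_div.
apply: (@le_trans _ _ (\sum_(i < n) B / n%:R * (2 * M * ((B + 4 * C') * e)))).
  apply: ler_sum => i _; apply: ler_pM; [exact: p0| |exact: pB|].
    apply: mulr_ge0; first exact: mulr_ge0.
    by rewrite addr_ge0 ?p0// mulr_ge0//; exact: (mean_gap_ge0 hnu hX mu z).
  rewrite ler_wpM2l ?mulr_ge0// [leRHS]mulrDl lerD//.
    by rewrite (le_trans (pB i))// ler_wpM2l.
  have -> : 4 * C' * e = 2 * (2 * C' * e) by ring.
  by rewrite ler_wpM2l.
rewrite (eq_bigr (fun=> B * (2 * M * ((B + 4 * C') * e)) / n%:R)) => [|i _].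
  by rewrite sum_ord_div// !mulrA.
by rewrite mulrAC.
Qed.

End order_statistics.

Lemma near_ln_nat (R : realType) (Q : R -> Prop) :
  (\forall L \near +oo, Q L) -> \forall n \near \oo, Q (ln n%:R).
Proof.
move=> [A [_ AQ]]; near=> n; apply: AQ.
have h : expR A + 1 <= n%:R by near: n; exact: nbhs_infty_ger.
have h' : expR A < n%:R by apply: lt_le_trans h; rewrite ltrDl.
by rewrite -[A]expRK ltr_ln ?posrE ?expR_gt0// (lt_trans _ h')// expR_gt0.
Unshelve. all: by end_near. Qed.

Theorem corollary2 (R : realType) (D : set R) (nu : probability R R)
  (hnu : reward_law D nu)
  (d : nat -> measure_display) (T : forall n : nat, measurableType (d n))
  (P : forall n : nat, probability (T n) R)
  (X : forall n : nat, 'I_n -> 'I_n -> {RV (P n) >-> R})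
  (hX : forall n : nat, tournament D nu (X n))
  (mu sigma : R)
  (hmu : forall (n : nat) (i j : 'I_n), i != j ->
     ('E_(P n)[X n i j] = mu%:E)%E)
  (hsigma : forall (n : nat) (i j : 'I_n), i != j ->
     sigma = Num.sqrt (fine ('V_(P n)[X n i j])%E))
  (t : R) (j : nat) :
  let p := fun n : nat =>
    order_stat_cdf (X n) mu sigma (n - j)%N (gumbel_scale t n) in
  let L := expR (- expR (- t)) * \sum_(0 <= k < j.+1) expR (- t * k%:R) / k`!%:R in
  (p n @[n --> \oo] --> L) /\
  (fun n : nat => p n - L) =O_\oo (fun n : nat => ln (ln n%:R) ^+ 2 / ln n%:R : R).
Proof.
move=> p L.
(* Positivity needs two distinct players; the tournament with n = 2 provides them. *)
have s0 : 0 < sigma.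
  exact: (sigma_gt0 hnu (hX 2) (@hmu 2) (@hsigma 2) (i := ord0) (k := ord_max)).
have [g [M [gM gE]]] := poisson_stein (expR_gt0 (- t)) j.
have LE : expR (- expR (- t)) * \sum_(0 <= i < j.+1) expR (- t) ^+ i / i`!%:R = L.
  by rewrite /L; congr (_ * _); apply: eq_bigr => i _; rewrite expRM_natr.
rewrite LE in gE.
have [C HC] := tail_parameters t s0.
pose C' := `|2 * C + 1|; pose B := expR (- t) + C'.
pose K := M * C' + B * (2 * M * (B + 4 * C')).
have main : \forall n \near \oo, `|p n - L| <= K * rate (ln n%:R).
  near=> n.
  have nj : (j.+2 <= n)%N by near: n; exact: nbhs_infty_ge.
  have n1 : (1 < n)%N by exact: leq_trans nj.
  apply: (order_stat_cdf_estimate hnu (hX n) (@hmu n) (@hsigma n)) => //.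
  - by rewrite (leq_trans _ nj).
  - by near: n; exact: (near_ln_nat HC).
  - by near: n; exact: (near_ln_nat (near_ge 1)).
  - by near: n; exact: (near_ln_nat (near_ln_ge 1)).
  - by rewrite -[leLHS]mul1r; near: n; exact: (near_ln_nat (near_rate_le 1)).
  - rewrite -[X in X * _](lnK (x := n%:R)) ?posrE ?ltr0n ?(ltnW n1)//.
    by near: n; exact: (near_ln_nat near_small_tail).
have rate0 : \forall n \near \oo, 0 <= rate (ln n%:R) :> R.
  near=> n; rewrite divr_ge0 ?sqr_ge0//.
  by rewrite (le_trans ler01)//; near: n; exact: (near_ln_nat (near_ge 1)).
split.
  apply/cvgrPdist_le => eps eps0; near=> n; rewrite distrC.
  have h1 : `|p n - L| <= K * rate (ln n%:R) by near: n; exact: main.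
  (* Convergence is read off from the rate, which eventually lies below any eps/K. *)
  have h2 : K / eps * rate (ln n%:R) <= 1.
    by near: n; exact: (near_ln_nat (near_rate_le (K / eps))).
  apply: (le_trans h1); rewrite mulrAC ler_pdivrMr// mul1r in h2.
  exact: h2.
apply/eqOP; near=> k; near=> n.
have h1 : `|p n - L| <= K * rate (ln n%:R) by near: n; exact: main.
have h2 : 0 <= rate (ln n%:R) :> R by near: n; exact: rate0.
apply: (le_trans h1); rewrite -/(rate _) (ger0_norm h2) ler_wpM2r//.
Unshelve. all: by end_near. Qed.
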